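(* Let $(z_l,z_r)\in\mathbb S^3\times\mathbb S^3$. There is a homeomorphism between the space $\mathcal{G}\mathbb S^3(z_l,z_r)$ and the space of pairs of curves $(\gamma_l,\gamma_r)\in\mathcal{G}\mathbb S^2(z_l)\times\mathcal{G}\mathbb S^2(z_r)$ satisfying the condition $$\|\gamma_l'(t)\|=\|\gamma_r'(t)\|,\qquad \kappa_{\gamma_l}(t)>\kappa_{\gamma_r}(t),\qquad t\in[0,1].$$
   Context: Curves are smooth; spaces of curves carry the $C^\infty$ topology, and spaces of pairs the subspace topology of the product. For $n\in\{2,3\}$, a curve $\gamma:[0,1]\to\mathbb S^n\subset\mathbb R^{n+1}$ is generic if $\gamma(t),\gamma'(t),\dots,\gamma^{(n-1)}(t)$ are linearly independent for all $t\in[0,1]$. Its Frenet frame curve $\mathcal F_\gamma:[0,1]\to\mathrm{SO}_{n+1}$ has as first $n$ columns the result of applying Gram-Schmidt to $(\gamma(t),\dots,\gamma^{(n-1)}(t))$ and as last column the unique vector completing them to a positive orthonormal basis. Let $\mathbb H$ be the quaternions. Identify $\mathbb R^4$ with $\mathbb H$ (basis $e_1,\dots,e_4\leftrightarrow 1,\mathbf i,\mathbf j,\mathbf k$), $\mathbb R^3$ with the imaginary quaternions (basis $e_1,e_2,e_3\leftrightarrow\mathbf i,\mathbf j,\mathbf k$), and $\mathbb S^3$ with the unit quaternions, with unit $\mathbf 1$. Then $\mathrm{Spin}_3=\mathbb S^3$ with double cover $\Pi_3:\mathbb S^3\to\mathrm{SO}_3$, $\Pi_3(z)(h)=zh\bar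 z$, and $\mathrm{Spin}_4=\mathbb S^3\times\mathbb S^3$ with double cover $\Pi_4:\mathbb S^3\times\mathbb S^3\to\mathrm{SO}_4$, $\Pi_4(z_l,z_r)(q)=z_lq\bar z_r$. If $\mathcal F_\gamma(0)=I$, $\tilde{\mathcal F}_\gamma$ denotes the unique continuous lift of $\mathcal F_\gamma$ to $\mathrm{Spin}_{n+1}$ starting at the identity. For $z\in\mathrm{Spin}_{n+1}$, $\mathcal{G}\mathbb S^n(z)$ is the space of generic curves $\gamma:[0,1]\to\mathbb S^n$ with $\mathcal F_\gamma(0)=I$ and $\tilde{\mathcal F}_\gamma(1)=z$; for $n=3$ and $z=(z_l,z_r)$ one writes $\mathcal{G}\mathbb S^3(z_l,z_r)$. For a generic curve $\gamma$ in $\mathbb S^2$ (i.e. an immersion), $\mathbf t_\gamma=\gamma'/\|\gamma'\|$, $\mathbf n_\gamma=\gamma\times\mathbf t_\gamma$ (cross product in $\mathbb R^3$), and the geodesic curvature is $\kappa_\gamma(t)=\dfrac{\mathbf t_\gamma'(t)\cdot\mathbf n_\gamma(t)}{\|\gamma'(t)\|}$. *)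

(* Defs.v *)
From HB Require Import structures.
From mathcomp Require Import all_boot all_order all_algebra.
From mathcomp Require Import all_classical all_reals all_analysis.
From mathcomp Require Import ring.
Import Order.TTheory GRing.Theory Num.Theory.
Import numFieldNormedType.Exports.

Set Implicit Arguments.
Unset Strict Implicit.
Unset Printing Implicit Defensive.

Local Open Scope classical_set_scope.
Local Open Scope ring_scope.

(* The norm `|u| that the library puts on matrices is the sup norm: the
   Euclidean structure has to be introduced separately. *)
Definition dot (R : realType) m (u v : 'cV[R]_m) : R :=
  \sum_(i < m) u i 0 * v i 0.

Definition enorm (R : realType) m (u : 'cV[R]_m) : R := Num.sqrt (dot u u).

Definition sphere (R : realType) n : set 'cV[R]_n.+1 := [set u | enorm u = 1].

Definition cross (R : realType) (u v : 'cV[R]_3) : 'cV[R]_3 :=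
  \col_i [:: u 1 0 * v 2 0 - u 2 0 * v 1 0;
             u 2 0 * v 0 0 - u 0 0 * v 2 0;
             u 0 0 * v 1 0 - u 1 0 * v 0 0]`_i.

Definition SO (R : realType) n : set 'M[R]_n :=
  [set Q | Q^T *m Q = 1%:M /\ \det Q = 1].

Definition gram_schmidt (R : realType) m (s : seq 'cV[R]_m) : seq 'cV[R]_m :=
  foldl (fun us v => let w := v - \sum_(u <- us) dot v u *: u in
                     rcons us ((enorm w)^-1 *: w)) [::] s.

(* Quaternions, in the basis 1, i, j, k. *)
Definition quat (R : realType) := 'cV[R]_4.

Definition qmul (R : realType) (p q : quat R) : quat R :=
  \col_i [:: p 0 0 * q 0 0 - p 1 0 * q 1 0 - p 2 0 * q 2 0 - p 3 0 * q 3 0;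
             p 0 0 * q 1 0 + p 1 0 * q 0 0 + p 2 0 * q 3 0 - p 3 0 * q 2 0;
             p 0 0 * q 2 0 - p 1 0 * q 3 0 + p 2 0 * q 0 0 + p 3 0 * q 1 0;
             p 0 0 * q 3 0 + p 1 0 * q 2 0 - p 2 0 * q 1 0 + p 3 0 * q 0 0]`_i.

Definition qconj (R : realType) (q : quat R) : quat R :=
  \col_i [:: q 0 0; - q 1 0; - q 2 0; - q 3 0]`_i.

Definition qone (R : realType) : quat R := delta_mx 0 0.

Definition qimag (R : realType) (h : 'cV[R]_3) : quat R :=
  \col_i [:: 0; h 0 0; h 1 0; h 2 0]`_i.

Definition S3 (R : realType) : set (quat R) := @sphere R 3.
Arguments S3 R : clear implicits.

Lemma qone_S3 (R : realType) : S3 R (qone R).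
Proof.
rewrite /S3 /sphere /= /enorm /dot !big_ord_recl big_ord0 !mxE /=.
by rewrite !mulr0 mulr1 !addr0 sqrtr1.
Qed.

Definition S3one (R : realType) : S3 R := exist _ (qone R) (mem_set (qone_S3 R)).

(* Matrices, in the bases (i, j, k) and (1, i, j, k), of h |-> z h conj(z) and
   q |-> zl q conj(zr). *)
Definition Pi3 (R : realType) (z : S3 R) : 'M[R]_3 :=
  \matrix_(i, j) qmul (qmul (val z) (qimag (delta_mx j 0))) (qconj (val z))
                   (lift 0 i) 0.

Definition Pi4 (R : realType) (z : S3 R * S3 R) : 'M[R]_4 :=
  \matrix_(i, j) qmul (qmul (val z.1) (delta_mx j 0)) (qconj (val z.2)) i 0.

Lemma qmulDr (R : realType) (p : quat R) : {morph qmul p : x y / x + y}.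
Proof.
move=> x y; apply/colP => -[[|[|[|[|//]]]] Hi]; rewrite !mxE /=; ring.
Qed.

Lemma qmulDl (R : realType) (q : quat R) : {morph @qmul R ^~ q : x y / x + y}.
Proof.
move=> x y; apply/colP => -[[|[|[|[|//]]]] Hi]; rewrite !mxE /=; ring.
Qed.

Lemma qmulZr (R : realType) (p q : quat R) a : qmul p (a *: q) = a *: qmul p q.
Proof. by apply/colP => -[[|[|[|[|//]]]] Hi]; rewrite !mxE /=; ring. Qed.

Lemma qmulZl (R : realType) (p q : quat R) a : qmul (a *: p) q = a *: qmul p q.
Proof. by apply/colP => -[[|[|[|[|//]]]] Hi]; rewrite !mxE /=; ring. Qed.

Lemma qmul0r (R : realType) (p : quat R) : qmul p 0 = 0.
Proof. by have := qmulZr p 0 0; rewrite !scale0r. Qed.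

Lemma qmul0l (R : realType) (q : quat R) : qmul 0 q = 0.
Proof. by have := qmulZl 0 q 0; rewrite !scale0r. Qed.

Lemma qimagD (R : realType) : {morph @qimag R : x y / x + y}.
Proof.
by move=> x y; apply/colP => -[[|[|[|[|//]]]] Hi]; rewrite !mxE /= ?addr0.
Qed.

Lemma qimagZ (R : realType) a (h : 'cV[R]_3) : qimag (a *: h) = a *: qimag h.
Proof.
by apply/colP => -[[|[|[|[|//]]]] Hi]; rewrite !mxE /= ?mulr0.
Qed.

Lemma qimag0 (R : realType) : qimag (0 : 'cV[R]_3) = 0.
Proof. by have := qimagZ 0 (0 : 'cV[R]_3); rewrite !scale0r. Qed.

Lemma qmul_imag_re (R : realType) (z : quat R) (h : 'cV[R]_3) :
  qmul (qmul z (qimag h)) (qconj z) 0 0 = 0.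
Proof. by rewrite !mxE /=; ring. Qed.

Lemma cV_sum_delta (R : realType) m (h : 'cV[R]_m) :
  h = \sum_j h j 0 *: delta_mx j 0.
Proof.
rewrite {1}[h]matrix_sum_delta; apply: eq_bigr => j _.
by rewrite big_ord1 ord1.
Qed.

Lemma Pi3E (R : realType) (z : S3 R) (h : 'cV[R]_3) :
  qimag (Pi3 z *m h) = qmul (qmul (val z) (qimag h)) (qconj (val z)).
Proof.
rewrite {2}[h]cV_sum_delta.
rewrite (big_morph _ (@qimagD R) (@qimag0 R)).
rewrite (big_morph _ (qmulDr (val z)) (qmul0r _)).
rewrite (big_morph _ (qmulDl (qconj (val z))) (qmul0l _)).
have -> : Pi3 z *m h = \sum_j h j 0 *: col j (Pi3 z).
  apply/colP => i; rewrite !mxE summxE; apply: eq_bigr => j _.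
  by rewrite [in RHS]mxE [X in _ = _ * X]mxE mulrC.
rewrite (big_morph _ (@qimagD R) (@qimag0 R)).
apply: eq_bigr => j _; rewrite !qimagZ qmulZr qmulZl; congr (_ *: _).
have := qmul_imag_re (val z) (delta_mx j 0).
have E i : col j (Pi3 z) i 0 =
    qmul (qmul (val z) (qimag (delta_mx j 0))) (qconj (val z)) (lift 0 i) 0.
  by rewrite 2!mxE.
move: E; move: (qmul (qmul _ _) _) => w E w0.
apply/colP => -[[|k] Hi].
  by rewrite mxE /= -{1}w0; congr (w _ _); apply/val_inj.
rewrite mxE; case: k Hi => [|[|[|//]]] Hi;
  by rewrite [LHS]E; congr (w _ _); apply/val_inj.
Qed.

Lemma Pi4E (R : realType) (z : S3 R * S3 R) (q : quat R) :
  Pi4 z *m q = qmul (qmul (val z.1) q) (qconj (val z.2)).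
Proof.
rewrite {2}[q]cV_sum_delta.
rewrite (big_morph _ (qmulDr (val z.1)) (qmul0r _)).
rewrite (big_morph _ (qmulDl (qconj (val z.2))) (qmul0l _)).
apply/colP => i; rewrite mxE summxE; apply: eq_bigr => j _.
by rewrite qmulZr qmulZl [X in X * _]mxE [RHS]mxE mulrC.
Qed.

Definition I01 (R : realType) : set R := `[0, 1]%classic.
Arguments I01 R : clear implicits.

Lemma I01_0 (R : realType) : I01 R 0.
Proof. by rewrite /I01 /= in_itv /= lexx ler01. Qed.

Lemma I01_1 (R : realType) : I01 R 1.
Proof. by rewrite /I01 /= in_itv /= lexx ler01. Qed.

Definition zero01 (R : realType) : I01 R := exist _ 0 (mem_set (I01_0 R)).
Definition one01 (R : realType) : I01 R := exist _ 1 (mem_set (I01_1 R)).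

(* Maps on [0, 1] are functions on the subtype I01 R; as filters on that
   subtype are relative to [0, 1], derivatives at the endpoints are one-sided. *)
Definition diff_quot (R : realType) m (f : I01 R -> 'cV[R]_m) (t s : I01 R) :
  'cV[R]_m := (val s - val t)^-1 *: (f s - f t).

Definition deriv01 (R : realType) m (f : I01 R -> 'cV[R]_m) (t : I01 R) :
  'cV[R]_m := lim (diff_quot f t s @[s --> t^']).

Definition smooth (R : realType) m (f : I01 R -> 'cV[R]_m) : Prop :=
  forall k (t : I01 R), cvg (diff_quot (iter k (@deriv01 R m) f) t s @[s --> t^']).

Record curve (R : realType) m :=
  Curve { curve_fun :> I01 R -> 'cV[R]_m ; curve_smooth : smooth curve_fun }.

HB.instance Definition _ (R : realType) m := gen_eqMixin (curve R m).
HB.instance Definition _ (R : realType) m := gen_choiceMixin (curve R m).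

Definition jet (R : realType) m (g : curve R m) :
    prod_topology (fun _ : nat => {uniform I01 R -> 'cV[R]_m}) :=
  fun k => iter k (@deriv01 R m) g.

(* The C^oo topology: uniform convergence of the derivatives of each order. *)
HB.instance Definition _ (R : realType) m :=
  Topological.copy (curve R m) (initial_topology (@jet R m)).

Definition derivs (R : realType) m (g : curve R m) (n : nat) (t : I01 R) :
  seq 'cV[R]_m := [seq iter k (@deriv01 R m) g t | k <- iota 0 n].

Definition generic (R : realType) n (g : curve R n.+1) : Prop :=
  forall t, free (derivs g n t).

Definition is_frenet (R : realType) n (g : curve R n.+1) (t : I01 R)
    (Q : 'M[R]_n.+1) : Prop :=
  (forall i : 'I_n,
     col (widen_ord (leqnSn n) i) Q = (gram_schmidt (derivs g n t))`_i) /\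
  SO Q.

(* When g is generic, is_frenet g t holds for a unique matrix. *)
Definition frenet (R : realType) n (g : curve R n.+1) (t : I01 R) :
  'M[R]_n.+1 := xget 0 (is_frenet g t).

Definition is_lift (R : realType) n (Spin : topologicalType)
    (Pi : Spin -> 'M[R]_n) (e : Spin) (F : I01 R -> 'M[R]_n)
    (L : I01 R -> Spin) : Prop :=
  [/\ continuous L, L (zero01 R) = e & forall t, Pi (L t) = F t].

(* As lifts are unique, the existential says that the lift ends at z. *)
Definition GSn (R : realType) n (Spin : topologicalType)
    (Pi : Spin -> 'M[R]_n.+1) (e z : Spin) : set (curve R n.+1) :=
  [set g : curve R n.+1 |
     [/\ forall t, sphere (g t), generic g, frenet g (zero01 R) = 1%:M &
         exists2 L, is_lift Pi e (frenet g) L & L (one01 R) = z]].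

Definition GS2 (R : realType) (z : S3 R) : set (curve R 3) :=
  GSn (@Pi3 R) (S3one R) z.

Definition GS3 (R : realType) (zl zr : S3 R) : set (curve R 4) :=
  GSn (@Pi4 R) (S3one R, S3one R) (zl, zr).

Definition unit_tangent (R : realType) (g : curve R 3) (t : I01 R) : 'cV[R]_3 :=
  (enorm (deriv01 g t))^-1 *: deriv01 g t.

Definition unit_normal (R : realType) (g : curve R 3) (t : I01 R) : 'cV[R]_3 :=
  cross (g t) (unit_tangent g t).

Definition geod_curv (R : realType) (g : curve R 3) (t : I01 R) : R :=
  dot (deriv01 (unit_tangent g) t) (unit_normal g t) / enorm (deriv01 g t).

Definition GS2_pairs (R : realType) (zl zr : S3 R) :
    set (curve R 3 * curve R 3) :=
  [set p | [/\ GS2 zl p.1, GS2 zr p.2 &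
             forall t, enorm (deriv01 p.1 t) = enorm (deriv01 p.2 t) /\
                       geod_curv p.1 t > geod_curv p.2 t]].

Definition homeomorphic (X Y : topologicalType) : Prop :=
  exists (f : X -> Y) (g : Y -> X),
    [/\ continuous f, continuous g, cancel f g & cancel g f].

(* Main.v *)
(* With quaternions, a lift (a, b) of the frame of gamma gives
   gamma = a (qconj b), and the next frame vectors are T = a i (qconj b),
   N = a j (qconj b) and B = a k (qconj b). Hence T (qconj gamma) = a i (qconj a)
   and (qconj gamma) T = b i (qconj b): these are two curves on the 2-sphere
   whose frames are lifted by a and b. If gamma' = c1 T, T' = - c1 gamma + c2 N
   and K = <N', B>, both have speed c2, and their curvatures are (K + c1) / c2
   and (K - c1) / c2.
   Conversely, lifts a, b of the frames of two curves with the same speed c and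
   curvatures k_l, k_r satisfy a' = a (c k_l i + c k) / 2 and
   b' = b (c k_r i + c k) / 2, so that gamma = a (qconj b) has derivative
   c (k_l - k_r) / 2 a i (qconj b).
   Since a' is a polynomial in a, F and F' when a lifts F, all derivatives of a
   depend continuously on those of F as soon as a does. The latter follows from
   4 <z, w>^2 = 1 + tr ((Pi3 z)^T (Pi3 w)) for unit quaternions, the sign of
   <z, w> being constant by connectedness of [0, 1]. *)

Require Import Defs.
From mathcomp Require Import all_boot all_order all_algebra.
From mathcomp Require Import all_classical all_reals all_analysis.
From mathcomp Require Import ring lra.
Import Order.TTheory GRing.Theory Num.Theory.
Import numFieldNormedType.Exports.

Set Implicit Arguments.
Unset Strict Implicit.
Unset Printing Implicit Defensive.

Local Open Scope classical_set_scope.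
Local Open Scope ring_scope.

(** * Topology of the unit interval *)

(** Continuity of maps between spaces of curves is reduced to smoothness of families. A map from a
    space X to curves is seen as a function of a point of X and of t: [continuous_curve] makes a
    continuous map out of a smooth family, and [smooth_vfamily_curve] with [smooth_vfamily_comp]
    does the converse. What remains is closure of smooth families under sums, products, inverses,
    square roots and d/dt. The curves on the 2-sphere come from gamma by such operations. The way
    back does not: a lift is only known to exist, so its dependence on the curve has to be studied
    separately. The two conditions on pairs have distinct roles. The difference of the curvatures is
    2 c1 / c2, so the inequality reflects c1 > 0. Equality of the speeds makes the k-components of
    the two angular velocities cancel in gamma', which leaves a multiple of a i (qconj b). *)

Lemma cvg_mxP (R : realType) m n (T : Type) (F : set_system T) (FF : Filter F)
    (f : T -> 'M[R]_(m, n)) (M : 'M[R]_(m, n)) :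
  f x @[x --> F] --> M <-> forall i j, f x i j @[x --> F] --> M i j.
Proof.
split=> [fM i j|fM].
  exact: (cvg_comp _ _ fM (@coord_continuous _ _ _ i j M)).
apply/cvg_ballP => e e0.
have : \forall x \near F, forall i j, ball (M i j) e (f x i j).
  apply: filter_forall => i; apply: filter_forall => j.
  by move/cvg_ballP: (fM i j); apply.
by apply: filterS => x fx; split.
Qed.

Lemma val_continuous (X : topologicalType) (A : set X) :
  continuous (fun x : A => val x).
Proof. exact: initial_continuous. Qed.

Lemma continuous_valP (X Y : topologicalType) (A : set X) (f : Y -> A) :
  continuous (fun y => val (f y)) -> continuous f.
Proof. exact: continuous_comp_initial. Qed.

Lemma continuous_pair_at (X Y Z : topologicalType) (f : X -> Y) (g : X -> Z) x :
  {for x, continuous f} -> {for x, continuous g} ->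
  {for x, continuous (fun y => (f y, g y))}.
Proof. by move=> cf cg; exact: (cvg_pair cf cg). Qed.

Section unit_interval.
Variable R : realType.
Implicit Types s t : I01 R.

Lemma I01_itv t : 0 <= val t <= 1.
Proof. by have := set_valP t; rewrite /I01 /= in_itv. Qed.

(** A left inverse of [val], with the default value [zero01 R] outside [0, 1]. Through it,
    compactness of segments and the intermediate value theorem on the real line apply to the
    subtype. *)
Definition clamp (x : R) : I01 R :=
  if pselect (I01 R x) is left h then exist _ x (mem_set h) else zero01 R.

Lemma val_clamp x : 0 <= x <= 1 -> val (clamp x) = x.
Proof.
move=> x01; rewrite /clamp; by case: pselect.
Qed.

Lemma clampK t : clamp (val t) = t.
Proof. by apply: val_inj; rewrite val_clamp ?I01_itv. Qed.

Lemma clamp_continuous : {within `[0, 1], continuous clamp}.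
Proof.
apply/subspace_sigL_continuousP; apply: continuous_valP.
rewrite (_ : (fun y => val (sigL `[0, 1]%classic clamp y)) = val); last first.
  by apply: funext => t; rewrite /sigL /= clampK.
exact: val_continuous.
Qed.

Lemma compact_I01 : compact [set: I01 R].
Proof.
have -> : [set: I01 R] = clamp @` `[0, 1]%classic.
  apply/seteqP; split=> // t _; exists (val t); last exact: clampK.
  exact: set_valP.
apply: continuous_compact; first exact: clamp_continuous.
exact: segment_compact.
Qed.

Lemma I01_ballE t e s : ball t e s = (`|val t - val s| < e) :> Prop.
Proof. by []. Qed.

(** Uniqueness of limits along [t^'], hence of derivatives, rests on this. The nearby point lies to
    the right of t if t <= 1/2 and to the left otherwise, at distance at most 1/2, so it stays in
    [0, 1] even when t is an endpoint. *)
Lemma dnbhs_I01_proper t : ProperFilter t^'.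
Proof.
apply: Build_ProperFilter_ex => A /nbhs_ballP[e /= e0 eA].
have [t0 t1] := andP (I01_itv t).
pose d := Num.min (e / 2) (1 / 2).
have d0 : 0 < d by rewrite lt_min !divr_gt0.
have de : d < e by rewrite gt_min (_ : e / 2 < e) //; lra.
have d2 : d <= 1 / 2 by rewrite ge_min lexx orbT.
pose s := clamp (if val t <= 1 / 2 then val t + d else val t - d).
have vs : val s = if val t <= 1 / 2 then val t + d else val t - d.
  by apply: val_clamp; case: ifPn => [|]; rewrite ?ltNge => h; apply/andP; split; lra.
exists s; apply: eA.
  rewrite I01_ballE vs; case: ifPn => _.
    by rewrite opprD addNKr normrN gtr0_norm.
  by rewrite opprB addrC subrK gtr0_norm.
apply/eqP => st; have := congr1 val st; rewrite vs.
by case: ifPn => _; lra.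
Qed.

Lemma I01_pos_connected (f : I01 R -> R) :
  continuous f -> 0 < f (zero01 R) -> (forall t, f t != 0) ->
  forall t, 0 < f t.
Proof.
move=> cf f0 fn0 t; rewrite ltNge; apply/negP => ft.
have [t0 t1] := andP (I01_itv t).
have [|||c] := @IVT R (f \o clamp) 0 (val t) 0.
- exact: t0.
- have sub : (`[0, val t]%classic : set R) `<=` `[0, 1]%classic.
    by move=> x /=; rewrite !in_itv /= => /andP[-> /le_trans]; apply.
  apply: (continuous_subspaceW sub).
  apply: within_continuous_comp; last exact: clamp_continuous.
  by move=> x _; exact: cf.
- rewrite /= clampK.
  have -> : clamp 0 = zero01 R by apply: val_inj; rewrite val_clamp // lexx ler01.
  by rewrite ge_min le_max ft (ltW f0) orbT.
- by move=> _ /eqP; rewrite (negbTE (fn0 _)).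
Qed.

End unit_interval.

#[global] Hint Extern 0 (ProperFilter _) =>
  solve [apply: dnbhs_I01_proper] : typeclass_instances.

(** * Smooth families of functions *)

Definition diff_quot1 (R : realType) (f : I01 R -> R) (t s : I01 R) : R :=
  (val s - val t)^-1 * (f s - f t).

(** A relation instead of a [lim]: existence and value of the derivative are carried together
    through the rules of calculus. [deriv01E] goes back to [deriv01]. *)
Definition has_deriv (R : realType) (f : I01 R -> R) (t : I01 R) (l : R) : Prop :=
  diff_quot1 f t s @[s --> t^'] --> l.

Section scalar_derivative.
Variable R : realType.
Implicit Types (f g : I01 R -> R) (t : I01 R) (a b : R).

Lemma cvg_dnbhsP f t : f s @[s --> t^'] --> f t <-> f s @[s --> t] --> f t.
Proof. by split=> [/continuous_withinNx|cf]; last exact/continuous_withinNx. Qed.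

Lemma val_dnbhs0 t : val s - val t @[s --> t^'] --> (0 : R).
Proof.
rewrite -(subrr (val t)); apply: cvgB; last exact: cvg_cst.
by apply/(cvg_dnbhsP (fun s => val s)); exact: val_continuous.
Qed.

Lemma near_dnbhs_neq t : \forall s \near t^', val s - val t != 0.
Proof.
apply: filterS (nbhs_dnbhs_neq t) => s /eqP st.
by rewrite subr_eq0; apply/eqP => /val_inj.
Qed.

Lemma has_deriv_cvg f t a : has_deriv f t a -> f s @[s --> t^'] --> f t.
Proof.
move=> fa.
have h : f t + (val s - val t) * diff_quot1 f t s @[s --> t^'] --> f t.
  rewrite -[X in _ --> X]addr0 -(mul0r a).
  apply: cvgD; first exact: cvg_cst.
  by apply: cvgM => //; exact: val_dnbhs0.
apply: cvg_trans h; apply: near_eq_cvg; near=> s.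
by rewrite /diff_quot1 mulrA divff ?mul1r ?subrKC //; near: s; exact: near_dnbhs_neq.
Unshelve. all: by end_near. Qed.

Lemma has_deriv_uniq f t a b : has_deriv f t a -> has_deriv f t b -> a = b.
Proof. by move=> fa fb; apply: (cvg_unique _ fa fb); exact: Rhausdorff. Qed.

Lemma has_deriv_cst c t : has_deriv (fun=> c) t 0.
Proof.
rewrite /has_deriv /diff_quot1.
under eq_fun do rewrite subrr mulr0.
exact: cvg_cst.
Qed.

Lemma has_derivD f g t a b : has_deriv f t a -> has_deriv g t b ->
  has_deriv (fun s => f s + g s) t (a + b).
Proof.
move=> fa gb; rewrite /has_deriv.
rewrite (_ : diff_quot1 _ t = fun s => diff_quot1 f t s + diff_quot1 g t s).
  exact: cvgD.
by apply: funext => s; rewrite /diff_quot1 -mulrDr opprD addrACA.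
Qed.

Lemma has_derivM f g t a b : has_deriv f t a -> has_deriv g t b ->
  has_deriv (fun s => f s * g s) t (a * g t + f t * b).
Proof.
move=> fa gb; rewrite /has_deriv.
rewrite (_ : diff_quot1 _ t =
    fun s => diff_quot1 f t s * g s + f t * diff_quot1 g t s).
  apply: cvgD; first by apply: cvgM => //; exact: has_deriv_cvg gb.
  by apply: cvgM => //; exact: cvg_cst.
by apply: funext => s; rewrite /diff_quot1; ring.
Qed.

Lemma has_derivN f t a : has_deriv f t a -> has_deriv (fun s => - f s) t (- a).
Proof.
move=> /(has_derivM (has_deriv_cst (-1) t)); rewrite mul0r add0r mulN1r.
by under eq_fun do rewrite mulN1r.
Qed.

Lemma has_derivB f g t a b : has_deriv f t a -> has_deriv g t b ->
  has_deriv (fun s => f s - g s) t (a - b).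
Proof. by move=> fa /has_derivN; exact: has_derivD. Qed.

Lemma has_deriv_sum I (r : seq I) (f : I -> I01 R -> R) (a : I -> R) t :
  (forall i, has_deriv (f i) t (a i)) ->
  has_deriv (fun s => \sum_(i <- r) f i s) t (\sum_(i <- r) a i).
Proof.
move=> fa; elim: r => [|i r IH].
  rewrite big_nil; under eq_fun do rewrite big_nil; exact: has_deriv_cst.
rewrite big_cons; under eq_fun do rewrite big_cons; exact: has_derivD.
Qed.

Lemma has_derivV f t a : f t != 0 -> has_deriv f t a ->
  has_deriv (fun s => (f s)^-1) t (- a * (f t)^-1 ^+ 2).
Proof.
move=> ft0 fa; have fc := has_deriv_cvg fa.
have h : - diff_quot1 f t s * (f s)^-1 * (f t)^-1 @[s --> t^'] -->
    - a * (f t)^-1 * (f t)^-1.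
  apply: cvgM; last exact: cvg_cst.
  by apply: cvgM; [exact: cvgN | exact: cvgV].
rewrite expr2 mulrA; apply: cvg_trans h; apply: near_eq_cvg; near=> s.
have fs0 : f s != 0.
  near: s; have /cvgr_neq0 := fc; exact.
rewrite /diff_quot1; field; rewrite ft0 fs0 /=.
by near: s; exact: near_dnbhs_neq.
Unshelve. all: by end_near. Qed.

(** Divide f(s)^2 - f(t)^2 by f(s) + f(t), whose limit is not zero. This serves for square roots,
    and for lifts, where the frames only determine the square of an inner product. *)
Lemma has_deriv_of_sqr f t a : f s @[s --> t] --> f t -> f t != 0 ->
  has_deriv (fun s => f s ^+ 2) t a -> has_deriv f t (a / (2 * f t)).
Proof.
move=> /cvg_dnbhsP fc ft0 fa.
have ft2 : f t + f t != 0 by rewrite -mulr2n mulrn_eq0.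
have h : diff_quot1 (fun s => f s ^+ 2) t s * (f s + f t)^-1 @[s --> t^'] -->
    a * (f t + f t)^-1.
  apply: cvgM => //; apply: cvgV => //.
  by apply: cvgD => //; exact: cvg_cst.
rewrite mulr_natl mulr2n; apply: cvg_trans h; apply: near_eq_cvg; near=> s.
have fs0 : f s + f t != 0.
  near: s; have /cvgr_neq0 : f s + f t @[s --> t^'] --> f t + f t; last exact.
  by apply: cvgD => //; exact: cvg_cst.
rewrite /diff_quot1; field; rewrite fs0 ?andbT /=.
by near: s; exact: near_dnbhs_neq.
Unshelve. all: by end_near. Qed.

End scalar_derivative.

(* [smooth_family k f]: as a function of two variables, f is continuous and has
   k derivatives in t which are continuous in (x, t). Since [0, 1] is compact,
   joint continuity amounts to continuity of x |-> f x for uniform convergence. *)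
Fixpoint smooth_family (R : realType) (X : topologicalType) (k : nat)
    (f : X -> I01 R -> R) : Prop :=
  continuous (fun p : X * I01 R => f p.1 p.2) /\
  if k is k'.+1 then exists2 g, (forall x t, has_deriv (f x) t (g x t)) &
                                smooth_family k' g
  else True.

Section smooth_family.
Variables (R : realType) (X : topologicalType).
Implicit Types (f g : X -> I01 R -> R) (k : nat).

Lemma smooth_family_continuous k f :
  smooth_family k f -> continuous (fun p : X * I01 R => f p.1 p.2).
Proof. by case: k => [|k] []. Qed.

Lemma smooth_family_continuous_at k f x : smooth_family k f -> continuous (f x).
Proof.
move=> /smooth_family_continuous cf t.
have := @continuous_comp _ _ _ (fun s => (x, s)) (fun p : X * I01 R => f p.1 p.2) t.
apply; last exact: cf.
by apply: continuous_pair_at; [exact: cst_continuous | exact: cvg_id].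
Qed.

Lemma smooth_familyW k f : smooth_family k.+1 f -> smooth_family k f.
Proof.
elim: k f => [|k IH] f [cf [g fg sg]]; split => //.
by exists g => //; exact: IH.
Qed.

Lemma smooth_family_cst k c : smooth_family k (fun (_ : X) (_ : I01 R) => c).
Proof.
have cc : continuous (fun _ : X * I01 R => c) by move=> p; exact: cvg_cst.
elim: k c cc => [|k IH] c cc; split => //.
exists (fun _ _ => 0); first by move=> x t; exact: has_deriv_cst.
by apply: IH => p; exact: cvg_cst.
Qed.

Lemma smooth_familyD k f g : smooth_family k f -> smooth_family k g ->
  smooth_family k (fun x t => f x t + g x t).
Proof.
elim: k f g => [|k IH] f g [cf sf] [cg sg]; split => //;
  try by move=> p; apply: cvgD; [exact: cf | exact: cg].
case: sf sg => f' ff' sf' [g' gg' sg'].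
exists (fun x t => f' x t + g' x t); last exact: IH.
by move=> x t; exact: has_derivD.
Qed.

(** The derivative contains [f] and [g] themselves, which [smooth_familyW] supplies at the lower
    order of the induction hypothesis. Inverse and square root follow the same scheme. *)
Lemma smooth_familyM k f g : smooth_family k f -> smooth_family k g ->
  smooth_family k (fun x t => f x t * g x t).
Proof.
elim: k f g => [|k IH] f g sf sg; (split;
  first by move=> p; apply: cvgM;
    [exact: (smooth_family_continuous sf) | exact: (smooth_family_continuous sg)]).
  by [].
have [sf0 sg0] := (smooth_familyW sf, smooth_familyW sg).
case: sf sg => _ [f' ff' sf'] [_ [g' gg' sg']].
exists (fun x t => f' x t * g x t + f x t * g' x t).
  by move=> x t; exact: has_derivM.
by apply: smooth_familyD; exact: IH.
Qed.

Lemma smooth_familyN k f : smooth_family k f ->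
  smooth_family k (fun x t => - f x t).
Proof.
move=> /(smooth_familyM (smooth_family_cst k (-1))).
by under eq_fun do under eq_fun do rewrite mulN1r.
Qed.

Lemma smooth_family_sum k I (r : seq I) (f : I -> X -> I01 R -> R) :
  (forall i, smooth_family k (f i)) ->
  smooth_family k (fun x t => \sum_(i <- r) f i x t).
Proof.
move=> sf; elim: r => [|i r IH].
  by under eq_fun do under eq_fun do rewrite big_nil; exact: smooth_family_cst.
by under eq_fun do under eq_fun do rewrite big_cons; exact: smooth_familyD.
Qed.

Lemma smooth_familyV k f : (forall x t, f x t != 0) -> smooth_family k f ->
  smooth_family k (fun x t => (f x t)^-1).
Proof.
move=> f0; elim: k => [|k IH] sf; (split;
  first by move=> p; apply: cvgV => //; exact: (smooth_family_continuous sf)).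
  by [].
have sV := IH (smooth_familyW sf).
case: sf => _ [f' ff' sf'].
exists (fun x t => - f' x t * (f x t)^-1 ^+ 2).
  by move=> x t; exact: has_derivV.
by apply: smooth_familyM; [exact: smooth_familyN | exact: smooth_familyM].
Qed.

Lemma smooth_family_sqrt k f : (forall x t, 0 < f x t) -> smooth_family k f ->
  smooth_family k (fun x t => Num.sqrt (f x t)).
Proof.
move=> f0; elim: k => [|k IH] sf; (have cs : continuous
    (fun p : X * I01 R => Num.sqrt (f p.1 p.2)) by
  move=> p; apply: (@continuous_comp _ _ _ (fun p : X * I01 R => f p.1 p.2) Num.sqrt);
  [exact: (smooth_family_continuous sf) | exact: sqrt_continuous]); split => //.
have sS := IH (smooth_familyW sf).
have S0 x t : Num.sqrt (f x t) != 0 by rewrite gt_eqF // sqrtr_gt0.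
case: sf => _ [f' ff' sf'].
exists (fun x t => f' x t / (2 * Num.sqrt (f x t))).
  move=> x t; apply: has_deriv_of_sqr => //.
    exact: (@smooth_family_continuous_at 0 (fun x t => Num.sqrt (f x t)) x).
  rewrite (_ : (fun s => _) = f x) //.
  by apply: funext => s; rewrite sqr_sqrtr ?ltW.
apply: smooth_familyM => //; apply: smooth_familyV.
  by move=> x t; rewrite mulf_neq0 // pnatr_eq0.
by apply: smooth_familyM => //; exact: smooth_family_cst.
Qed.

End smooth_family.

Lemma smooth_family_comp (R : realType) (X Y : topologicalType) k (h : Y -> X)
    (f : X -> I01 R -> R) :
  continuous h -> smooth_family k f -> smooth_family k (fun y => f (h y)).
Proof.
move=> ch; elim: k f => [|k IH] f [cf sf]; split => //;
  try (move=> p;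
    apply: (@continuous_comp _ _ _ (fun p : Y * I01 R => (h p.1, p.2))
      (fun q : X * I01 R => f q.1 q.2));
      [apply: continuous_pair_at; [apply: (cvg_comp _ _ cvg_fst); exact: ch | exact: cvg_snd]
      | exact: cf]).
by case: sf => g fg sg; exists (fun y => g (h y)) => //; exact: IH.
Qed.

(** Tube argument: near each t, joint continuity puts both [f x s] and [f y s] within e/2 of
    [f x t], and compactness of [0, 1] gives one neighbourhood of x that works for all t. *)
Lemma near_uniform_I01 (R : realType) (X : topologicalType) (V : pseudoMetricType R)
    (f : X -> I01 R -> V) (x : X) (e : R) :
  continuous (fun p : X * I01 R => f p.1 p.2) -> 0 < e ->
  \forall y \near x, forall t, ball (f x t) e (f y t).
Proof.
move=> cf e0.
have /compact_near_coveringP cov := @compact_I01 R.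
have : \forall y \near x, [set: I01 R] `<=` (fun t => ball (f x t) e (f y t)).
  apply: cov => t _.
  have e20 : 0 < e / 2 by rewrite divr_gt0.
  have /cvg_ballP /(_ _ e20) [[A B] /= [xA tB] AB] := cf (x, t).
  exists (B, A) => //= -[s y] /= [Bs Ay].
  have xs : ball (f x t) (e / 2) (f x s).
    by apply: (AB (x, s)); split => //; exact: nbhs_singleton.
  have ys : ball (f x t) (e / 2) (f y s) by apply: (AB (y, s)).
  exact: ball_splitr xs ys.
by apply: filterS => y fy t; exact: fy.
Qed.

(** * Vector-valued families and the C^oo topology *)

Section vector_families.
Variable R : realType.

Definition has_vderiv m (f : I01 R -> 'cV[R]_m) (t : I01 R) (v : 'cV[R]_m) : Prop :=
  forall i, has_deriv (fun s => f s i 0) t (v i 0).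

Definition smooth_vfamily (X : topologicalType) m (f : X -> I01 R -> 'cV[R]_m) : Prop :=
  forall i k, smooth_family k (fun x t => f x t i 0).

Lemma has_vderivP m (f : I01 R -> 'cV[R]_m) t v :
  has_vderiv f t v <-> diff_quot f t s @[s --> t^'] --> v.
Proof.
have E i s : diff_quot f t s i 0 = diff_quot1 (fun s => f s i 0) t s.
  by rewrite !mxE.
split=> [fv|/cvg_mxP fv i].
  apply/cvg_mxP => i j; rewrite ord1.
  by under eq_fun do rewrite E; exact: fv.
by have := fv i 0; under eq_fun do rewrite E.
Qed.

Lemma deriv01E m (f : I01 R -> 'cV[R]_m) t v : has_vderiv f t v -> deriv01 f t = v.
Proof.
move=> /has_vderivP fv; have fl : cvg (diff_quot f t s @[s --> t^']).
  by apply/cvg_ex; exists v.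
apply/colP => i; apply: (@has_deriv_uniq R (fun s => f s i 0) t).
  by move: fl i => /has_vderivP.
by move: fv i => /has_vderivP.
Qed.

Lemma smooth_vfamily_deriv (X : topologicalType) m (f : X -> I01 R -> 'cV[R]_m) :
  smooth_vfamily f -> forall x t, has_vderiv (f x) t (deriv01 (f x) t).
Proof.
move=> sf x t.
suff [v fv] : exists v, has_vderiv (f x) t v by rewrite (deriv01E fv).
have ex i : exists a, has_deriv (fun s => f x s i 0) t a.
  by have [_ [g fg _]] := sf i 1; exists (g x t).
by case: (choice ex) => a fa; exists (\col_i a i) => i; rewrite mxE.
Qed.

Arguments smooth_vfamily_deriv {X m f} sf x t i.

Lemma smooth_vfamily_deriv01 (X : topologicalType) m (f : X -> I01 R -> 'cV[R]_m) :
  smooth_vfamily f -> smooth_vfamily (fun x => deriv01 (f x)).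
Proof.
move=> sf i k; have [_ [g fg sg]] := sf i k.+1.
rewrite (_ : (fun x t => _) = g) //; apply: funext => x; apply: funext => t.
exact: has_deriv_uniq (smooth_vfamily_deriv sf x t i) (fg x t).
Qed.

Lemma smooth_vfamily_iter (X : topologicalType) m (f : X -> I01 R -> 'cV[R]_m) n :
  smooth_vfamily f -> smooth_vfamily (fun x => iter n (@deriv01 R m) (f x)).
Proof.
by move=> sf; elim: n => // n IH; exact: (smooth_vfamily_deriv01 IH).
Qed.

Lemma smooth_vfamily_smooth (X : topologicalType) m (f : X -> I01 R -> 'cV[R]_m) :
  smooth_vfamily f -> forall x, smooth (f x).
Proof.
move=> sf x k t; apply/cvg_ex; exists (deriv01 (iter k (@deriv01 R m) (f x)) t).
by apply/has_vderivP; exact: (smooth_vfamily_deriv (smooth_vfamily_iter k sf)).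
Qed.

Lemma smooth_vfamily_comp (X Y : topologicalType) m (h : Y -> X)
    (f : X -> I01 R -> 'cV[R]_m) :
  continuous h -> smooth_vfamily f -> smooth_vfamily (fun y => f (h y)).
Proof. by move=> ch sf i k; exact: (smooth_family_comp ch (sf i k)). Qed.

Lemma smooth_vfamily_continuous (X : topologicalType) m (f : X -> I01 R -> 'cV[R]_m) :
  smooth_vfamily f -> continuous (fun p : X * I01 R => f p.1 p.2).
Proof.
move=> sf p; apply/cvg_mxP => i j; rewrite ord1.
exact: (smooth_family_continuous (sf i 0)).
Qed.

(** The topology on curves is initial for [jet], so each derivative can be treated alone; its
    uniform closeness is [near_uniform_I01]. *)
Lemma continuous_curve (X : topologicalType) m (F : X -> curve R m) :
  smooth_vfamily F -> continuous F.
Proof.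
move=> sF; apply: continuous_comp_initial => x; apply/cvg_sup => n.
apply: (@continuous_comp_initial _ X _ (fun h : nat -> {uniform I01 R -> 'cV[R]_m} => h n)
  (fun x => jet (F x))).
move=> {}x A /uniform_nbhs[E []]; rewrite -entourage_ballE => -[e /= e0 eE] EA.
have := @near_uniform_I01 _ _ _ (fun x => iter n (@deriv01 R m) (F x)) x e
  (smooth_vfamily_continuous (smooth_vfamily_iter n sF)) e0.
by apply: filterS => y xy; apply: EA => t _; apply: eE; exact: xy.
Qed.

Lemma jet_continuous m n :
  continuous (fun g : curve R m => iter n (@deriv01 R m) g : {uniform I01 R -> 'cV[R]_m}).
Proof.
move=> g; apply: (@continuous_comp _ _ _ (@jet R m) (fun h => h n)).
  exact: initial_continuous.
exact: (@proj_continuous nat (fun=> {uniform I01 R -> 'cV[R]_m}) n).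
Qed.

Lemma curve_has_vderiv m n (g : curve R m) t :
  has_vderiv (iter n (@deriv01 R m) g) t (iter n.+1 (@deriv01 R m) g t).
Proof. by apply/has_vderivP; exact: curve_smooth. Qed.

Arguments curve_has_vderiv {m} n g t i.

(** The universal family: composed with a continuous map from X to curves, it shows that the map is
    a smooth family. Joint continuity combines uniform closeness of h to g with continuity of g in
    t. *)
Lemma smooth_vfamily_curve m : smooth_vfamily (fun (g : curve R m) t => g t).
Proof.
(* All derivatives are treated at once, since differentiating the n-th one leads to the (n+1)-st. *)
move=> i k; suff : forall n, smooth_family k
    (fun (g : curve R m) t => iter n (@deriv01 R m) g t i 0) by move/(_ 0).
have cont n : continuous
    (fun p : curve R m * I01 R => iter n (@deriv01 R m) p.1 p.2 i 0).
  move=> [g t] /=; apply/cvg_ballP => e e0.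
  have e20 : 0 < e / 2 by rewrite divr_gt0.
  have near_g : \forall h \near g, forall s : I01 R,
      ball (iter n (@deriv01 R m) g s i 0) (e / 2) (iter n (@deriv01 R m) (curve_fun h) s i 0).
    pose B := [set h : I01 R -> 'cV[R]_m |
      forall s, setT s -> ball (iter n (@deriv01 R m) g s) (e / 2) (h s)].
    have nB : nbhs (iter n (@deriv01 R m) g : {uniform I01 R -> 'cV[R]_m}) B.
      apply/uniform_nbhs; exists [set xy | ball xy.1 (e / 2) xy.2]; split => //.
      by rewrite -entourage_ballE; exists (e / 2).
    have gB : nbhs g ((fun h : curve R m => iter n (@deriv01 R m) h) @^-1` B).
      exact: (@jet_continuous m n g _ nB).
    by apply: filterS gB => h gh s; have [_] := gh s Logic.I; apply.
  have near_t : \forall s \near t,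
      ball (iter n (@deriv01 R m) g t i 0) (e / 2) (iter n (@deriv01 R m) g s i 0).
    have /has_deriv_cvg /cvg_dnbhsP := curve_has_vderiv n g t i.
    by move/cvg_ballP; apply.
  exists ([set h : curve R m | forall s,
      ball (iter n (@deriv01 R m) g s i 0) (e / 2) (iter n (@deriv01 R m) h s i 0)],
    [set s | ball (iter n (@deriv01 R m) g t i 0) (e / 2)
      (iter n (@deriv01 R m) g s i 0)]) => //= -[h s] /= [gh ts].
  exact: ball_split ts (gh s).
elim: k => [|k IH] n; split; try exact: cont; first by [].
exists (fun (g : curve R m) t => iter n.+1 (@deriv01 R m) g t i 0); last exact: IH.
by move=> g t; exact: curve_has_vderiv.
Qed.

End vector_families.

Arguments smooth_vfamily_deriv {R X m f} sf x t i.
Arguments smooth_vfamily_smooth {R X m f} sf x k t.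
Arguments curve_has_vderiv {R m} n g t i.

Lemma ord3_ind (P : 'I_3 -> Prop) : P 0 -> P 1 -> P 2 -> forall i, P i.
Proof.
move=> P0 P1 P2 [[|[|[|//]]] Hi].
- by rewrite (_ : Ordinal Hi = 0) //; exact: val_inj.
- by rewrite (_ : Ordinal Hi = 1) //; exact: val_inj.
- by rewrite (_ : Ordinal Hi = 2) //; exact: val_inj.
Qed.

Lemma ord4_ind (P : 'I_4 -> Prop) : P 0 -> P 1 -> P 2 -> P 3 -> forall i, P i.
Proof.
move=> P0 P1 P2 P3 [[|[|[|[|//]]]] Hi].
- by rewrite (_ : Ordinal Hi = 0) //; exact: val_inj.
- by rewrite (_ : Ordinal Hi = 1) //; exact: val_inj.
- by rewrite (_ : Ordinal Hi = 2) //; exact: val_inj.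
- by rewrite (_ : Ordinal Hi = 3) //; exact: val_inj.
Qed.

Lemma coordD (R : realType) m (u v : 'cV[R]_m) i : (u + v) i 0 = u i 0 + v i 0.
Proof. by rewrite mxE. Qed.

Lemma coordN (R : realType) m (u : 'cV[R]_m) i : (- u) i 0 = - u i 0.
Proof. by rewrite mxE. Qed.

Lemma coordZ (R : realType) m a (u : 'cV[R]_m) i : (a *: u) i 0 = a * u i 0.
Proof. by rewrite mxE. Qed.

(** * Quaternions and the spin covers *)

Section quaternions.
Variable R : realType.
Implicit Types p q r z : quat R.

Lemma quatP p q : p 0 0 = q 0 0 -> p 1 0 = q 1 0 -> p 2 0 = q 2 0 -> p 3 0 = q 3 0 ->
  p = q.
Proof.
by move=> e0 e1 e2 e3; apply/colP; exact: ord4_ind.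
Qed.

Lemma qmul_re p q : qmul p q 0 0 =
  p 0 0 * q 0 0 - p 1 0 * q 1 0 - p 2 0 * q 2 0 - p 3 0 * q 3 0.
Proof. by rewrite mxE. Qed.
Lemma qmul_i p q : qmul p q 1 0 =
  p 0 0 * q 1 0 + p 1 0 * q 0 0 + p 2 0 * q 3 0 - p 3 0 * q 2 0.
Proof. by rewrite mxE. Qed.
Lemma qmul_j p q : qmul p q 2 0 =
  p 0 0 * q 2 0 - p 1 0 * q 3 0 + p 2 0 * q 0 0 + p 3 0 * q 1 0.
Proof. by rewrite mxE. Qed.
Lemma qmul_k p q : qmul p q 3 0 =
  p 0 0 * q 3 0 + p 1 0 * q 2 0 - p 2 0 * q 1 0 + p 3 0 * q 0 0.
Proof. by rewrite mxE. Qed.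
Definition qmulE := (qmul_re, qmul_i, qmul_j, qmul_k).

Lemma qconj_re q : qconj q 0 0 = q 0 0. Proof. by rewrite mxE. Qed.
Lemma qconj_i q : qconj q 1 0 = - q 1 0. Proof. by rewrite mxE. Qed.
Lemma qconj_j q : qconj q 2 0 = - q 2 0. Proof. by rewrite mxE. Qed.
Lemma qconj_k q : qconj q 3 0 = - q 3 0. Proof. by rewrite mxE. Qed.
Definition qconjE := (qconj_re, qconj_i, qconj_j, qconj_k).

Definition qbasis (j : 'I_4) : quat R := delta_mx j 0.

Lemma qbasisE (i j : 'I_4) : qbasis j i 0 = (i == j)%:R.
Proof. by rewrite mxE eqxx andbT. Qed.

Lemma quat_dotE p q : dot p q =
  p 0 0 * q 0 0 + p 1 0 * q 1 0 + p 2 0 * q 2 0 + p 3 0 * q 3 0.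
Proof.
rewrite /dot !big_ord_recl big_ord0 addr0 !addrA.
by congr (_ + _ + _ + _); congr (p _ 0 * q _ 0); apply: val_inj.
Qed.

Lemma qmulA p q r : qmul p (qmul q r) = qmul (qmul p q) r.
Proof. by apply: quatP; rewrite !qmulE; ring. Qed.

Lemma qconjM p q : qconj (qmul p q) = qmul (qconj q) (qconj p).
Proof. by apply: quatP; rewrite !(qmulE, qconjE); ring. Qed.

Lemma qconjK q : qconj (qconj q) = q.
Proof. by apply: quatP; rewrite !qconjE ?opprK. Qed.

Lemma qoneE : qone R = qbasis 0. Proof. by []. Qed.

Lemma qmulq1 q : qmul q (qone R) = q.
Proof. by apply: quatP; rewrite qmulE qoneE !qbasisE /=; ring. Qed.

Lemma qmul1q q : qmul (qone R) q = q.
Proof. by apply: quatP; rewrite qmulE qoneE !qbasisE /=; ring. Qed.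

Lemma qmulqV q : qmul q (qconj q) = dot q q *: qone R.
Proof.
by apply: quatP; rewrite qmulE !qconjE mxE qoneE !qbasisE quat_dotE /=; ring.
Qed.

Lemma qmulVq q : qmul (qconj q) q = dot q q *: qone R.
Proof.
by apply: quatP; rewrite qmulE !qconjE mxE qoneE !qbasisE quat_dotE /=; ring.
Qed.

Lemma dot_qmull p q r : dot (qmul p q) r = dot q (qmul (qconj p) r).
Proof. by rewrite !quat_dotE !(qmulE, qconjE); ring. Qed.

Lemma dot_qmulr p q r : dot (qmul p q) r = dot p (qmul r (qconj q)).
Proof. by rewrite !quat_dotE !(qmulE, qconjE); ring. Qed.

Lemma qmul_ij : qmul (qbasis 1) (qbasis 2) = qbasis 3.
Proof. by apply: quatP; rewrite qmulE !qbasisE /=; ring. Qed.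

End quaternions.

(** * The Euclidean inner product *)

Section euclidean.
Variables (R : realType) (m : nat).
Implicit Types (u v w : 'cV[R]_m) (a : R).

Lemma dotC u v : dot u v = dot v u.
Proof. by apply: eq_bigr => i _; exact: mulrC. Qed.

Lemma dotDl u v w : dot (u + v) w = dot u w + dot v w.
Proof. by rewrite -big_split; apply: eq_bigr => i _; rewrite mxE mulrDl. Qed.

Lemma dotZl a u v : dot (a *: u) v = a * dot u v.
Proof. by rewrite mulr_sumr; apply: eq_bigr => i _; rewrite mxE mulrA. Qed.

Lemma dotDr u v w : dot w (u + v) = dot w u + dot w v.
Proof. by rewrite dotC dotDl !(dotC w). Qed.

Lemma dotZr a u v : dot u (a *: v) = a * dot u v.
Proof. by rewrite dotC dotZl dotC. Qed.

Lemma dotNl u v : dot (- u) v = - dot u v.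
Proof. by rewrite -scaleN1r dotZl mulN1r. Qed.

Lemma dotNr u v : dot u (- v) = - dot u v.
Proof. by rewrite dotC dotNl dotC. Qed.

Lemma dotBl u v w : dot (u - v) w = dot u w - dot v w.
Proof. by rewrite dotDl dotNl. Qed.

Lemma dotBr u v w : dot w (u - v) = dot w u - dot w v.
Proof. by rewrite dotDr dotNr. Qed.

Lemma dot0l u : dot 0 u = 0.
Proof. by rewrite -(scale0r 0) dotZl mul0r. Qed.

Lemma dot_ge0 u : 0 <= dot u u.
Proof. by apply: sumr_ge0 => i _; rewrite -expr2 sqr_ge0. Qed.

Lemma sqr_coord_le_dot u i : u i 0 ^+ 2 <= dot u u.
Proof.
rewrite /dot (bigD1 i) //= -expr2 lerDl; apply: sumr_ge0 => j _.
by rewrite -expr2 sqr_ge0.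
Qed.

Lemma dot_eq0 u : dot u u = 0 -> u = 0.
Proof.
move=> u0; apply/colP => i; rewrite mxE; apply/eqP; rewrite -sqrf_eq0.
by rewrite eq_le sqr_ge0 -u0 sqr_coord_le_dot.
Qed.

Lemma enorm_ge0 u : 0 <= enorm u.
Proof. exact: sqrtr_ge0. Qed.

Lemma enorm_sqr u : enorm u ^+ 2 = dot u u.
Proof. by rewrite sqr_sqrtr ?dot_ge0. Qed.

Lemma enorm1P u : enorm u = 1 <-> dot u u = 1.
Proof.
split=> [u1|u1]; first by rewrite -enorm_sqr u1 expr1n.
by rewrite /enorm u1 sqrtr1.
Qed.

Lemma enormZ a u : enorm (a *: u) = `|a| * enorm u.
Proof.
by rewrite /enorm dotZl dotZr mulrA -expr2 sqrtrM ?sqr_ge0 // sqrtr_sqr.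
Qed.

(** As the inverse of 0 is 0, normalizing the zero vector gives 0 and not a unit vector. This is how
    nonvanishing of speeds is read off the columns of an orthogonal frame. *)
Lemma normalize_unit u : dot ((enorm u)^-1 *: u) ((enorm u)^-1 *: u) = 1 ->
  0 < enorm u.
Proof.
move=> u1; rewrite lt_neqAle enorm_ge0 andbT eq_sym; apply/eqP => u0.
by move: u1; rewrite u0 invr0 scale0r dot0l => /eqP; rewrite eq_sym oner_eq0.
Qed.

End euclidean.

(** * The action of pairs of unit quaternions *)

Section spin.
Variable R : realType.
Implicit Types (p q : quat R) (z a b : S3 R).

Lemma S3_dot z : dot (val z) (val z) = 1.
Proof. by apply/enorm1P; exact: (set_valP z). Qed.

(* Pi4 (a, b) is q |-> spin a b q. *)
Definition spin a b q : quat R := qmul (qmul (val a) q) (qconj (val b)).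

Lemma qmulS3V z : qmul (val z) (qconj (val z)) = qone R.
Proof. by rewrite qmulqV S3_dot scale1r. Qed.

Lemma qmulS3K z q : qmul (qconj (val z)) (qmul (val z) q) = q.
Proof. by rewrite qmulA qmulVq S3_dot scale1r qmul1q. Qed.

Lemma qmulS3VK z q : qmul (val z) (qmul (qconj (val z)) q) = q.
Proof. by rewrite qmulA qmulS3V qmul1q. Qed.

Lemma spinD a b p q : spin a b (p + q) = spin a b p + spin a b q.
Proof. by rewrite /spin qmulDr qmulDl. Qed.

Lemma spinZ a b c q : spin a b (c *: q) = c *: spin a b q.
Proof. by rewrite /spin qmulZr qmulZl. Qed.

Lemma spin_inj a b p q : spin a b p = spin a b q -> p = q.
Proof.
rewrite /spin => /(congr1 (fun r => qmul (qconj (val a)) (qmul r (val b)))).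
by rewrite -!qmulA !qmulS3K qmulVq S3_dot scale1r !qmulq1.
Qed.

Lemma dot_spin a b p q : dot (spin a b p) (spin a b q) = dot p q.
Proof.
rewrite /spin dot_qmulr -[qmul (qmul _ _) _]qmulA qconjK qmulVq S3_dot scale1r.
by rewrite qmulq1 dot_qmull qmulS3K.
Qed.

Lemma spin_mulVr a a' b p q :
  qmul (spin a b p) (qconj (spin a' b q)) = spin a a' (qmul p (qconj q)).
Proof. by rewrite /spin !qconjM qconjK -!qmulA qmulS3K. Qed.

Lemma spin_mulVl a b b' p q :
  qmul (qconj (spin a b p)) (spin a b' q) = spin b b' (qmul (qconj p) q).
Proof. by rewrite /spin !qconjM qconjK -!qmulA qmulS3K. Qed.

Lemma spin_mulr a b c p q :
  qmul (spin a b p) (spin b c q) = spin a c (qmul p q).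
Proof. by rewrite /spin -!qmulA qmulS3K. Qed.

Lemma spin1 a : spin a a (qone R) = qone R.
Proof. by rewrite /spin qmulq1 qmulS3V. Qed.

Lemma col_Pi4 (z : S3 R * S3 R) j : col j (Pi4 z) = spin z.1 z.2 (qbasis R j).
Proof. by apply/colP => i; rewrite mxE [LHS]mxE. Qed.

(** The imaginary part: a left inverse of [qimag], and its adjoint by [dot_qvec]. *)
Definition qvec q : 'cV[R]_3 := \col_i q (lift 0 i) 0.

Lemma qvec_qimag (h : 'cV[R]_3) : qvec (qimag h) = h.
Proof.
by apply/colP => -[[|[|[|//]]] Hi]; rewrite !mxE /=; congr (h _ _); exact: val_inj.
Qed.

Lemma qimag_coord (h : 'cV[R]_3) j : qimag h (lift 0 j) 0 = h j 0.
Proof. by rewrite -[in RHS](qvec_qimag h) !mxE. Qed.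

Lemma dot_qvec q (h : 'cV[R]_3) : dot (qvec q) h = dot q (qimag h).
Proof.
rewrite /dot [RHS]big_ord_recl [X in _ * X]mxE /= mulr0 add0r.
by apply: eq_bigr => i _; rewrite qimag_coord mxE.
Qed.

Lemma qimag_delta (j : 'I_3) : qimag (delta_mx j 0) = qbasis R (lift 0 j).
Proof.
apply/colP => i; rewrite qbasisE; have [j' ->|->] := unliftP 0 i.
  by rewrite qimag_coord mxE eqxx andbT (inj_eq lift_inj).
by rewrite mxE.
Qed.

Lemma qimag_col_Pi3 z (j : 'I_3) :
  qimag (col j (Pi3 z)) = spin z z (qbasis R (lift 0 j)).
Proof. by rewrite colE Pi3E qimag_delta. Qed.

Lemma col_Pi3 z (j : 'I_3) : col j (Pi3 z) = qvec (spin z z (qbasis R (lift 0 j))).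
Proof. by rewrite -qimag_col_Pi3 qvec_qimag. Qed.

Lemma dot_qimag (h k : 'cV[R]_3) : dot (qimag h) (qimag k) = dot h k.
Proof. by rewrite -dot_qvec qvec_qimag. Qed.

Lemma dot_qbasis i j : dot (qbasis R i) (qbasis R j) = (i == j)%:R.
Proof.
rewrite /dot (bigD1 i) //= big1 ?addr0; last first.
  by move=> k ki; rewrite qbasisE (negbTE ki) mul0r.
by rewrite !qbasisE eqxx mul1r.
Qed.

Lemma Pi3_col_dot z i j : dot (col i (Pi3 z)) (col j (Pi3 z)) = (i == j)%:R.
Proof.
by rewrite -dot_qimag !qimag_col_Pi3 dot_spin dot_qbasis (inj_eq lift_inj).
Qed.

Lemma Pi4_col_dot (z : S3 R * S3 R) i j : dot (col i (Pi4 z)) (col j (Pi4 z)) = (i == j)%:R.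
Proof. by rewrite !col_Pi4 dot_spin dot_qbasis. Qed.

(** The cross product is the imaginary part of the quaternion product, and conjugation by z is
    multiplicative, so the claim reduces to i j = k. *)
Lemma cross_Pi3 z : cross (col 0 (Pi3 z)) (col 1 (Pi3 z)) = col 2 (Pi3 z).
Proof.
have crossE (u v : 'cV[R]_3) : cross u v = qvec (qmul (qimag u) (qimag v)).
  by apply/colP => -[[|[|[|//]]] Hi]; rewrite !mxE /=; ring.
rewrite crossE !qimag_col_Pi3 spin_mulr col_Pi3; congr (qvec (spin _ _ _)).
rewrite (_ : lift 0 0 = 1); last exact: val_inj.
rewrite (_ : lift 0 1 = 2); last exact: val_inj.
rewrite (_ : lift 0 2 = 3); last exact: val_inj.
exact: qmul_ij.
Qed.

Lemma orthonormal_colsP n (Q : 'M[R]_n) :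
  Q^T *m Q = 1%:M <-> forall i j, dot (col i Q) (col j Q) = (i == j)%:R.
Proof.
have E i j : (Q^T *m Q) i j = dot (col i Q) (col j Q).
  by rewrite mxE; apply: eq_bigr => k _; rewrite !mxE.
split=> [QQ i j|QQ]; first by rewrite -E QQ mxE.
by apply/matrixP => i j; rewrite E QQ mxE.
Qed.

(** Indexing the entries by natural numbers through [inord] lets the lifted indices of the cofactors
    compute, so that [ring] recognizes equal entries. *)
Lemma det3 (A : 'M[R]_3) (f := fun i j : nat => A (inord i) (inord j)) :
  \det A = f 0 0 * (f 1 1 * f 2 2 - f 1 2 * f 2 1)
         - f 0 1 * (f 1 0 * f 2 2 - f 1 2 * f 2 0)
         + f 0 2 * (f 1 0 * f 2 1 - f 1 1 * f 2 0).
Proof.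
have fE i j : A i j = f i j by rewrite /f !inord_val.
rewrite (expand_det_row _ 0) !big_ord_recl big_ord0 /cofactor.
rewrite ![\det (row' _ _)](expand_det_row _ 0) !big_ord_recl !big_ord0 /cofactor.
by rewrite !det_mx11 !mxE !fE /bump /= /bump /=; ring.
Qed.

Lemma det4 (A : 'M[R]_4) (f := fun i j : nat => A (inord i) (inord j))
    (m := fun i j k => f 1 i * (f 2 j * f 3 k - f 2 k * f 3 j)
                     - f 1 j * (f 2 i * f 3 k - f 2 k * f 3 i)
                     + f 1 k * (f 2 i * f 3 j - f 2 j * f 3 i)) :
  \det A = f 0 0 * m 1 2 3 - f 0 1 * m 0 2 3 + f 0 2 * m 0 1 3 - f 0 3 * m 0 1 2.
Proof.
have fE i j : A i j = f i j by rewrite /f !inord_val.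
rewrite (expand_det_row _ 0) !big_ord_recl big_ord0 /cofactor !det3.
by rewrite !mxE !fE /= !inordK //= /bump /= /m; ring.
Qed.

Lemma inord3E : (inord 0 = 0 :> 'I_3) * (inord 1 = 1 :> 'I_3) * (inord 2 = 2 :> 'I_3).
Proof. by do !split; apply: val_inj; rewrite /= inordK. Qed.

Lemma inord4E : (inord 0 = 0 :> 'I_4) * (inord 1 = 1 :> 'I_4) *
  (inord 2 = 2 :> 'I_4) * (inord 3 = 3 :> 'I_4).
Proof. by do !split; apply: val_inj; rewrite /= inordK. Qed.

(** The determinant is the triple product of the columns, and the cross product of the first two is
    the third, a unit vector. *)
Lemma det_Pi3 z : \det (Pi3 z) = 1.
Proof.
have E i j : Pi3 z i j = col j (Pi3 z) i 0 by rewrite [RHS]mxE.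
rewrite det3 !inord3E.
transitivity (dot (cross (col 0 (Pi3 z)) (col 1 (Pi3 z))) (col 2 (Pi3 z))); last first.
  by rewrite cross_Pi3 Pi3_col_dot.
rewrite !E; move: (col 0 _) (col 1 _) (col 2 _) => u v w.
rewrite /dot !big_ord_recl big_ord0.
rewrite (_ : lift ord0 (lift ord0 ord0) = 2); last exact: val_inj.
rewrite (_ : lift ord0 ord0 = 1); last exact: val_inj.
by rewrite !mxE /=; ring.
Qed.

Lemma eq_mulmx (m n : nat) (A B : 'M[R]_(m, n)) :
  (forall v : 'cV[R]_n, A *m v = B *m v) -> A = B.
Proof.
move=> AB; apply/matrixP => i j.
by have /colP /(_ i) := AB (delta_mx j 0); rewrite -!colE !mxE.
Qed.

Lemma qconj1 : qconj (qone R) = qone R.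
Proof. by apply: quatP; rewrite qconjE qoneE !qbasisE /= ?oppr0. Qed.

(* Left and right multiplications by quaternions have sparse enough matrices for
   a direct expansion of the determinant. *)
Lemma det_Pi4 (z : S3 R * S3 R) : \det (Pi4 z) = 1.
Proof.
case: z => a b.
have -> : Pi4 (a, b) = Pi4 (a, S3one R) *m Pi4 (S3one R, b).
  by apply: eq_mulmx => q; rewrite -mulmxA !Pi4E /= qconj1 qmulq1 qmul1q qmulA.
have E (y : S3 R * S3 R) i j : Pi4 y i j = spin y.1 y.2 (qbasis R j) i 0.
  by rewrite -col_Pi4 [RHS]mxE.
rewrite det_mulmx !det4 !inord4E !E /spin /= qconj1 !qmulq1 !qmul1q.
set P := (X in X * _); set Q := (X in _ * X).
have -> : P = dot (val a) (val a) ^+ 2.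
  by rewrite /P !qmulE !qbasisE quat_dotE /=; ring.
have -> : Q = dot (val b) (val b) ^+ 2.
  by rewrite /Q !qmulE !qconjE !qbasisE quat_dotE /=; ring.
by rewrite !S3_dot !expr1n mulr1.
Qed.

Lemma SO_Pi3 z : SO (Pi3 z).
Proof. by split; [exact/orthonormal_colsP/Pi3_col_dot | exact: det_Pi3]. Qed.

Lemma SO_Pi4 (z : S3 R * S3 R) : SO (Pi4 z).
Proof. by split; [exact/orthonormal_colsP/Pi4_col_dot | exact: det_Pi4]. Qed.

Lemma Pi3_one : Pi3 (S3one R) = 1%:M.
Proof.
apply: eq_mulmx => h; rewrite mul1mx -[LHS]qvec_qimag Pi3E /= qconj1 qmulq1.
by rewrite qmul1q qvec_qimag.
Qed.

Lemma Pi4_one : Pi4 (S3one R, S3one R) = 1%:M.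
Proof. by apply: eq_mulmx => q; rewrite mul1mx Pi4E /= qconj1 qmulq1 qmul1q. Qed.

Lemma sum_conj_qbasis q :
  \sum_j qmul (qmul (qbasis R j) q) (qconj (qbasis R j)) = 4 * q 0 0 *: qone R.
Proof.
rewrite !big_ord_recl big_ord0 addr0.
rewrite (_ : lift ord0 (lift ord0 (lift ord0 ord0)) = 3); last exact: val_inj.
rewrite (_ : lift ord0 (lift ord0 ord0) = 2); last exact: val_inj.
rewrite (_ : lift ord0 ord0 = 1); last exact: val_inj.
by apply: quatP; rewrite coordZ !coordD !qmulE !qconjE qoneE !qbasisE /=; ring.
Qed.

Lemma qmul_conj_re p q : qmul (qconj p) q 0 0 = dot p q.
Proof. by rewrite qmulE !qconjE quat_dotE; ring. Qed.

(* [\sum_e e q (qconj e)] is four times the real part of q when e ranges over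
   1, i, j, k; apply this to [q = qconj z * w]. *)
Lemma Pi3_recover z w : 4 * dot (val z) (val w) *: val z =
  qmul (qone R + \sum_j qmul (qimag (col j (Pi3 z))) (qconj (qimag (col j (Pi3 w)))))
    (val w).
Proof.
(* The 1 is the term of index 0: it completes the sum over i, j, k to a sum over the whole basis. *)
have -> : qone R = qmul (spin z z (qbasis R 0)) (qconj (spin w w (qbasis R 0))).
  by rewrite -qoneE !spin1 qconj1 qmulq1.
under eq_bigr do rewrite !qimag_col_Pi3.
rewrite -[_ + _](big_ord_recl _ (fun j =>
  qmul (spin z z (qbasis R j)) (qconj (spin w w (qbasis R j))))).
rewrite (big_morph _ (qmulDl (val w)) (qmul0l _)).
under eq_bigr => j _.
  rewrite (_ : qmul _ _ = qmul (val z) (qmul (qmul (qbasis R j)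
    (qmul (qconj (val z)) (val w))) (qconj (qbasis R j)))); last first.
    by rewrite /spin !qconjM qconjK -!qmulA qmulVq S3_dot scale1r qmulq1.
  over.
rewrite -(big_morph _ (qmulDr (val z)) (qmul0r _)) sum_conj_qbasis.
by rewrite qmul_conj_re qmulZr qmulq1.
Qed.

End spin.

(** * Derivatives of vector-valued families *)

Section vector_derivative.
Variable R : realType.
Implicit Types t : I01 R.

Lemma has_vderiv_uniq m (f : I01 R -> 'cV[R]_m) t u v :
  has_vderiv f t u -> has_vderiv f t v -> u = v.
Proof. by move=> /deriv01E <- /deriv01E <-. Qed.

Lemma has_vderiv_cst m (v : 'cV[R]_m) t : has_vderiv (fun=> v) t 0.
Proof. by move=> i; rewrite mxE; exact: has_deriv_cst. Qed.

Lemma has_vderivD m (f g : I01 R -> 'cV[R]_m) t u v :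
  has_vderiv f t u -> has_vderiv g t v -> has_vderiv (fun s => f s + g s) t (u + v).
Proof.
move=> fu gv i; rewrite mxE; under eq_fun do rewrite mxE.
exact: has_derivD (fu i) (gv i).
Qed.

Lemma has_vderivZ m (a : I01 R -> R) (f : I01 R -> 'cV[R]_m) t b u :
  has_deriv a t b -> has_vderiv f t u ->
  has_vderiv (fun s => a s *: f s) t (b *: f t + a t *: u).
Proof.
move=> ab fu i; rewrite !mxE; under eq_fun do rewrite mxE.
exact: has_derivM ab (fu i).
Qed.

Lemma has_deriv_dot m (f g : I01 R -> 'cV[R]_m) t u v :
  has_vderiv f t u -> has_vderiv g t v ->
  has_deriv (fun s => dot (f s) (g s)) t (dot u (g t) + dot (f t) v).
Proof.
move=> fu gv; rewrite /dot -big_split /=.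
by apply: has_deriv_sum => i; exact: has_derivM (fu i) (gv i).
Qed.

Lemma dot_deriv_unit m (f : I01 R -> 'cV[R]_m) t u :
  (forall s, dot (f s) (f s) = 1) -> has_vderiv f t u -> dot u (f t) = 0.
Proof.
move=> f1 fu; have h := has_deriv_dot fu fu.
have : dot u (f t) + dot (f t) u = 0.
  apply: (has_deriv_uniq h); under eq_fun do rewrite f1.
  exact: has_deriv_cst.
by rewrite (dotC (f t)) -mulr2n => /eqP; rewrite mulrn_eq0 /= => /eqP.
Qed.

Lemma has_vderiv_qmul (f g : I01 R -> quat R) t u v :
  has_vderiv f t u -> has_vderiv g t v ->
  has_vderiv (fun s => qmul (f s) (g s)) t (qmul u (g t) + qmul (f t) v).
Proof.
move=> fu gv.
have M i j : has_deriv (fun s => f s i 0 * g s j 0) t (u i 0 * g t j 0 + f t i 0 * v j 0).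
  exact: has_derivM (fu i) (gv j).
move=> i; elim/ord4_ind: i; rewrite coordD !qmulE; under eq_fun do rewrite qmulE.
- have := has_derivB (has_derivB (has_derivB (M 0 0) (M 1 1)) (M 2 2)) (M 3 3).
  by congr has_deriv; ring.
- have := has_derivB (has_derivD (has_derivD (M 0 1) (M 1 0)) (M 2 3)) (M 3 2).
  by congr has_deriv; ring.
- have := has_derivD (has_derivD (has_derivB (M 0 2) (M 1 3)) (M 2 0)) (M 3 1).
  by congr has_deriv; ring.
- have := has_derivD (has_derivB (has_derivD (M 0 3) (M 1 2)) (M 2 1)) (M 3 0).
  by congr has_deriv; ring.
Qed.

Lemma has_vderiv_qconj (f : I01 R -> quat R) t u :
  has_vderiv f t u -> has_vderiv (fun s => qconj (f s)) t (qconj u).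
Proof.
move=> fu i; elim/ord4_ind: i; rewrite qconjE; under eq_fun do rewrite qconjE;
  [exact: fu | exact: has_derivN (fu _)..].
Qed.

Lemma has_vderiv_qvec (f : I01 R -> quat R) t u :
  has_vderiv f t u -> has_vderiv (fun s => qvec (f s)) t (qvec u).
Proof.
by move=> fu i; rewrite mxE; under eq_fun do rewrite mxE; exact: (fu (lift 0 i)).
Qed.

Lemma has_vderiv_qimag (f : I01 R -> 'cV[R]_3) t u :
  has_vderiv f t u -> has_vderiv (fun s => qimag (f s)) t (qimag u).
Proof.
move=> fu i; have [j ->|->] := unliftP 0 i.
  by rewrite qimag_coord; under eq_fun do rewrite qimag_coord; exact: fu.
rewrite mxE /=; under eq_fun do rewrite mxE /=.
exact: has_deriv_cst.
Qed.

End vector_derivative.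

Section smooth_vfamily_operations.
Variables (R : realType) (X : topologicalType).

Lemma smooth_vfamilyD m (f g : X -> I01 R -> 'cV[R]_m) :
  smooth_vfamily f -> smooth_vfamily g -> smooth_vfamily (fun x t => f x t + g x t).
Proof.
move=> sf sg i k; under eq_fun do under eq_fun do rewrite mxE.
exact: smooth_familyD (sf i k) (sg i k).
Qed.

Lemma smooth_vfamilyZ m (a : X -> I01 R -> R) (f : X -> I01 R -> 'cV[R]_m) :
  (forall k, smooth_family k a) -> smooth_vfamily f ->
  smooth_vfamily (fun x t => a x t *: f x t).
Proof.
move=> sa sf i k; under eq_fun do under eq_fun do rewrite mxE.
exact: smooth_familyM (sa k) (sf i k).
Qed.

Lemma smooth_family_dot m (f g : X -> I01 R -> 'cV[R]_m) k :
  smooth_vfamily f -> smooth_vfamily g ->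
  smooth_family k (fun x t => dot (f x t) (g x t)).
Proof.
move=> sf sg; apply: smooth_family_sum => i.
exact: smooth_familyM (sf i k) (sg i k).
Qed.

Lemma smooth_family_enorm m (f : X -> I01 R -> 'cV[R]_m) k :
  smooth_vfamily f -> (forall x t, 0 < enorm (f x t)) ->
  smooth_family k (fun x t => enorm (f x t)).
Proof.
move=> sf f0; apply: smooth_family_sqrt; last exact: smooth_family_dot.
by move=> x t; rewrite -sqrtr_gt0; exact: f0.
Qed.

Lemma smooth_vfamily_normalize m (f : X -> I01 R -> 'cV[R]_m) :
  smooth_vfamily f -> (forall x t, 0 < enorm (f x t)) ->
  smooth_vfamily (fun x t => (enorm (f x t))^-1 *: f x t).
Proof.
move=> sf f0; apply: smooth_vfamilyZ => // k; apply: smooth_familyV.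
  by move=> x t; rewrite gt_eqF.
exact: smooth_family_enorm.
Qed.

Lemma smooth_family_qmul k (f g : X -> I01 R -> quat R) :
  (forall i, smooth_family k (fun x t => f x t i 0)) ->
  (forall i, smooth_family k (fun x t => g x t i 0)) ->
  forall i, smooth_family k (fun x t => qmul (f x t) (g x t) i 0).
Proof.
move=> sf sg.
have M i j : smooth_family k (fun x t => f x t i 0 * g x t j 0).
  exact: smooth_familyM.
by move=> i; elim/ord4_ind: i; under eq_fun do under eq_fun do rewrite qmulE;
  repeat (first [exact: M | apply: smooth_familyD | apply: smooth_familyN]).
Qed.

Lemma smooth_vfamily_qmul (f g : X -> I01 R -> quat R) :
  smooth_vfamily f -> smooth_vfamily g -> smooth_vfamily (fun x t => qmul (f x t) (g x t)).
Proof.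
move=> sf sg i k; apply: (smooth_family_qmul _ _ i) => j; [exact: sf | exact: sg].
Qed.

Lemma smooth_vfamily_qconj (f : X -> I01 R -> quat R) :
  smooth_vfamily f -> smooth_vfamily (fun x t => qconj (f x t)).
Proof.
move=> sf i k; elim/ord4_ind: i; under eq_fun do under eq_fun do rewrite qconjE;
  try apply: smooth_familyN; exact: sf.
Qed.

Lemma smooth_vfamily_qvec (f : X -> I01 R -> quat R) :
  smooth_vfamily f -> smooth_vfamily (fun x t => qvec (f x t)).
Proof.
by move=> sf i k; under eq_fun do under eq_fun do rewrite mxE; exact: sf.
Qed.

Lemma smooth_vfamily_qimag (f : X -> I01 R -> 'cV[R]_3) :
  smooth_vfamily f -> smooth_vfamily (fun x t => qimag (f x t)).
Proof.
move=> sf i k; have [j ->|->] := unliftP 0 i.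
  by under eq_fun do under eq_fun do rewrite qimag_coord; exact: sf.
by under eq_fun do under eq_fun do rewrite mxE /=; exact: smooth_family_cst.
Qed.

End smooth_vfamily_operations.

(** * Frenet frames *)

Section frenet_frames.
Variable R : realType.

Lemma ord_widen_max n (i : 'I_n.+1) :
  i = ord_max \/ exists j : 'I_n, i = widen_ord (leqnSn n) j.
Proof.
have [j ->|->] := unliftP ord_max i; last by left.
by right; exists j; apply: val_inj; exact: lift_max.
Qed.

(** All entries of P^T Q other than the last diagonal one are those of the identity. The matrix is
    therefore triangular, and its last diagonal entry equals its determinant, which is 1. *)
Lemma SO_eq_cols n (P Q : 'M[R]_n.+1) : SO P -> SO Q ->
  (forall i : 'I_n, col (widen_ord (leqnSn n) i) P = col (widen_ord (leqnSn n) i) Q) ->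
  P = Q.
Proof.
move=> [PP dP] [QQ dQ] PQ; pose M := P^T *m Q.
have ME i j : M i j = dot (col i P) (col j Q).
  by rewrite mxE; apply: eq_bigr => k _; rewrite !mxE.
have M1 i j : (i, j) != (ord_max, ord_max) -> M i j = (i == j)%:R.
  rewrite ME; have [->|[j' ->]] := ord_widen_max j; last first.
    by move=> _; rewrite -PQ; have /orthonormal_colsP := PP; apply.
  have [->|[i' ->] _] := ord_widen_max i; first by rewrite !eqxx.
  by rewrite PQ; have /orthonormal_colsP := QQ; apply.
have dM : \det M = 1 by rewrite det_mulmx det_tr dP dQ mulr1.
have trigM : is_trig_mx M.
  apply/is_trig_mxP => i j ij; rewrite M1.
    by rewrite (_ : i == j = false) //; apply/negbTE; rewrite neq_ltn ij.
  by apply: contraTneq ij => -[-> ->]; rewrite ltnn.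
have Mmax : M ord_max ord_max = 1.
  move: dM; rewrite (det_trig trigM) (bigD1 ord_max) //= big1 ?mulr1 // => i imax.
  by rewrite M1 ?eqxx // xpair_eqE negb_and imax.
have -> : Q = P *m M by rewrite mulmxA (mulmx1C PP) mul1mx.
suff -> : M = 1%:M by rewrite mulmx1.
apply/matrixP => i j; rewrite [RHS]mxE.
have [[-> ->]|/M1 //] := eqVneq (i, j) (ord_max, ord_max).
by rewrite Mmax eqxx.
Qed.

Lemma frenet_eq n (g : curve R n.+1) t Q : is_frenet g t Q -> frenet g t = Q.
Proof.
move=> gQ; have [gF SOF] : is_frenet g t (frenet g t) by apply: xgetPex; exists Q.
case: gQ => gQ SOQ; apply: SO_eq_cols => // i; by rewrite gF gQ.
Qed.

(** The default value of [xget] in [frenet] is 0, whose determinant is not 1. Hence a frame that is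
    the image of a lift really is a Frenet frame. *)
Lemma frenet_SO n (g : curve R n.+1) t : SO (frenet g t) -> is_frenet g t (frenet g t).
Proof.
move=> [_ dF]; have [ex|nex] := pselect (exists Q, is_frenet g t Q).
  exact: xgetPex.
have F0 : frenet g t = 0 by apply: xgetPN => Q gQ; apply: nex; exists Q.
by move: dF; rewrite F0 det0 => /eqP; rewrite eq_sym oner_eq0.
Qed.

Lemma gram_schmidt2 m (a b : 'cV[R]_m) :
  gram_schmidt [:: a; b] =
  [:: (enorm a)^-1 *: a;
      let u := (enorm a)^-1 *: a in
      let w := b - dot b u *: u in (enorm w)^-1 *: w].
Proof.
by rewrite /gram_schmidt /= big_nil subr0 !big_cons !big_nil addr0.
Qed.

Lemma gram_schmidt3 m (a b c : 'cV[R]_m) :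
  gram_schmidt [:: a; b; c] =
  [:: (enorm a)^-1 *: a;
      let u := (enorm a)^-1 *: a in
      let w := b - dot b u *: u in (enorm w)^-1 *: w;
      let u := (enorm a)^-1 *: a in
      let w := b - dot b u *: u in
      let v := (enorm w)^-1 *: w in
      let x := c - (dot c u *: u + dot c v *: v) in
      (enorm x)^-1 *: x].
Proof.
by rewrite /gram_schmidt /= big_nil subr0 !big_cons !big_nil !addr0.
Qed.

Lemma normalizeZ m (c : R) (u : 'cV[R]_m) : 0 < c -> dot u u = 1 ->
  (enorm (c *: u))^-1 *: (c *: u) = u.
Proof.
move=> c0 /enorm1P u1.
by rewrite enormZ u1 mulr1 gtr0_norm // scalerA mulVf ?scale1r // gt_eqF.
Qed.

Lemma gram_schmidt2_eq m (u v : 'cV[R]_m) c :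
  dot u u = 1 -> dot v v = 1 -> dot u v = 0 -> 0 < c ->
  gram_schmidt [:: u; c *: v] = [:: u; v].
Proof.
move=> u1 v1 uv c0; rewrite gram_schmidt2.
have -> : (enorm u)^-1 *: u = u by rewrite -[in LHS](scale1r u) normalizeZ.
by rewrite /= dotZl dotC uv mulr0 scale0r subr0 normalizeZ.
Qed.

(** Gram-Schmidt undoes a triangular change of basis with positive diagonal, here 1, c, d. The signs
    of c and d are what fixes the orientation of the second and third vectors. *)
Lemma gram_schmidt3_eq m (u v w : 'cV[R]_m) c a b d :
  dot u u = 1 -> dot v v = 1 -> dot w w = 1 ->
  dot u v = 0 -> dot u w = 0 -> dot v w = 0 -> 0 < c -> 0 < d ->
  gram_schmidt [:: u; c *: v; a *: u + b *: v + d *: w] = [:: u; v; w].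
Proof.
move=> u1 v1 w1 uv uw vw c0 d0; rewrite gram_schmidt3.
have -> : (enorm u)^-1 *: u = u by rewrite -[in LHS](scale1r u) normalizeZ.
rewrite /= dotZl (dotC v u) uv mulr0 scale0r subr0 normalizeZ //.
rewrite !dotDl !dotZl (dotC v u) !(dotC w) u1 v1 uv uw vw.
rewrite !mulr0 !mulr1 !addr0 add0r.
by rewrite [_ + d *: w - _]addrAC subrr add0r normalizeZ.
Qed.

Lemma free_triangular3 m (u v w : 'cV[R]_m) c a b d :
  dot u u = 1 -> dot v v = 1 -> dot w w = 1 ->
  dot u v = 0 -> dot u w = 0 -> dot v w = 0 -> c != 0 -> d != 0 ->
  free [:: u; c *: v; a *: u + b *: v + d *: w].
Proof.
move=> u1 v1 w1 uv uw vw c0 d0.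
apply/(@freeP _ _ 3 [tuple u; c *: v; a *: u + b *: v + d *: w]) => k.
rewrite !big_ord_recl big_ord0 addr0 /= => E.
set k0 := k ord0 in E; set k1 := k _ in E; set k2 := k _ in E.
(* Back substitution: pair the relation with w, then v, then u. *)
have Ew : k2 * d = 0.
  have := congr1 (fun x => dot x w) E.
  by rewrite !(dotDl, dotZl, dot0l) uw vw w1 !(mulr0, add0r, addr0, mulr1).
have k20 : k2 = 0 by move/eqP: Ew; rewrite mulf_eq0 (negbTE d0) orbF => /eqP.
have Ev : k1 * c = 0.
  have := congr1 (fun x => dot x v) E.
  by rewrite k20 !(dotDl, dotZl, dot0l) uv v1 !(mulr0, mul0r, add0r, addr0, mulr1).
have k10 : k1 = 0 by move/eqP: Ev; rewrite mulf_eq0 (negbTE c0) orbF => /eqP.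
have k00 : k0 = 0.
  have := congr1 (fun x => dot x u) E.
  by rewrite k20 k10 !(dotDl, dotZl, dot0l) u1 !(mulr0, mul0r, add0r, addr0, mulr1).
by apply: ord3_ind; [rewrite -k00 | rewrite -k10 | rewrite -k20];
  congr (k _); exact: val_inj.
Qed.

End frenet_frames.

(** * Smooth dependence of lifts *)

Section lifting.
Variable R : realType.
Implicit Types (z w : S3 R) (t : I01 R).

(** The product rule solved for the derivative of f, differentiability of f being a conclusion. The
    difference quotients satisfy an exact identity in which only u(t) is inverted. *)
Lemma has_deriv_mulK (u f : I01 R -> R) t a b :
  f s @[s --> t] --> f t -> u t != 0 -> has_deriv u t a ->
  has_deriv (fun s => u s * f s) t b -> has_deriv f t ((b - a * f t) / u t).
Proof.
move=> /cvg_dnbhsP cf u0 ua ufb; rewrite /has_deriv.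
rewrite (_ : diff_quot1 f t = fun s =>
  (diff_quot1 (fun s => u s * f s) t s - diff_quot1 u t s * f s) / u t).
  apply: cvgM; last exact: cvg_cst.
  by apply: cvgB => //; exact: cvgM.
by apply: funext => s; rewrite /diff_quot1; move: (_^-1) => d; field.
Qed.

Lemma cvg_dot m (T : Type) (F : set_system T) (FF : Filter F)
    (f g : T -> 'cV[R]_m) (u v : 'cV[R]_m) :
  (forall i, f x i 0 @[x --> F] --> u i 0) -> (forall i, g x i 0 @[x --> F] --> v i 0) ->
  dot (f x) (g x) @[x --> F] --> dot u v.
Proof.
move=> fu gv; rewrite /dot; apply: cvg_big => [|i _]; first exact: add_continuous.
exact: cvgM.
Qed.

(** Pair [Pi3_recover] with w. The sum of the products of columns is the trace of (Pi3 z)^T (Pi3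
    w). *)
Lemma sum_dot_Pi3 z w :
  1 + \sum_j dot (col j (Pi3 z)) (col j (Pi3 w)) = 4 * dot (val z) (val w) ^+ 2.
Proof.
have := congr1 (fun q => dot q (val w)) (Pi3_recover z w).
rewrite dotZl -mulrA -expr2 => ->.
rewrite dot_qmulr qmulS3V dotDl qoneE dot_qbasis eqxx; congr (_ + _).
rewrite [X in dot X _](eq_bigr (fun j => qmul (qimag (col j (Pi3 z)))
  (qconj (qimag (col j (Pi3 w)))))) //.
rewrite (big_morph (fun p => dot p (qbasis R 0)) (fun p q => dotDl p q _) (dot0l _)).
by apply: eq_bigr => j _; rewrite dot_qmulr qconjK -qoneE qmul1q dot_qimag.
Qed.

Lemma dot_subS3 z w :
  dot (val z - val w) (val z - val w) = 2 - 2 * dot (val z) (val w).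
Proof. by rewrite dotBl !dotBr !S3_dot (dotC (val w)); ring. Qed.

Lemma dotS3_le1 z w : dot (val z) (val w) <= 1.
Proof. by have := dot_ge0 (val z - val w); rewrite dot_subS3; lra. Qed.

Lemma S3_continuous (X : topologicalType) (L : X -> S3 R) :
  continuous L <-> forall i, continuous (fun x => val (L x) i 0).
Proof.
split=> [cL i x|cL].
  have cv : {for x, continuous (fun x => val (L x))}.
    by apply: continuous_comp; [exact: cL | exact: val_continuous].
  by have /cvg_mxP := cv; apply.
by apply: continuous_valP => x; apply/cvg_mxP => i j; rewrite ord1; exact: cL.
Qed.

(** The bound e <= 1 keeps the square of the inner product positive, so the inner product never
    vanishes. It starts at 1 and stays positive; being at most 1, it is then at least its square. *)
Lemma lift_close (L1 L2 : I01 R -> S3 R) e :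
  continuous L1 -> continuous L2 -> L1 (zero01 R) = L2 (zero01 R) -> e <= 1 ->
  (forall t, 1 - e < (1 + \sum_j dot (col j (Pi3 (L1 t))) (col j (Pi3 (L2 t)))) / 4) ->
  forall t, 1 - e < dot (val (L1 t)) (val (L2 t)).
Proof.
move=> c1 c2 L0 e1 close.
have close2 t : 1 - e < dot (val (L1 t)) (val (L2 t)) ^+ 2.
  by have := close t; rewrite sum_dot_Pi3; lra.
have pos : forall t, 0 < dot (val (L1 t)) (val (L2 t)).
  apply: I01_pos_connected.
  - move=> t; apply: (@cvg_dot _ _ (nbhs t)) => i.
      by move/S3_continuous: c1; exact.
    by move/S3_continuous: c2; exact.
  - by rewrite L0 S3_dot.
  - move=> t; apply/eqP => d0; have := close2 t.
    by rewrite d0 expr0n /=; lra.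
move=> t; apply: (lt_le_trans (close2 t)).
by rewrite expr2 ler_piMr ?dotS3_le1 // ltW.
Qed.

(** Equal frames satisfy the hypothesis of [lift_close] for every positive e <= 1, so the inner
    product of the two unit quaternions is 1 and their distance is 0. *)
Lemma lift_uniq (L1 L2 : I01 R -> S3 R) :
  continuous L1 -> continuous L2 -> L1 (zero01 R) = L2 (zero01 R) ->
  (forall t, Pi3 (L1 t) = Pi3 (L2 t)) -> L1 = L2.
Proof.
move=> c1 c2 L0 P; apply: funext => t; apply: val_inj; apply/eqP.
rewrite -subr_eq0; apply/eqP; apply: dot_eq0; rewrite dot_subS3.
suff : 1 <= dot (val (L1 t)) (val (L2 t)).
  by have := dotS3_le1 (L1 t) (L2 t); lra.
apply/ler_addgt0Pl => e e0.
have [e1|e1] := leP e 1; last first.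
  have := @lift_close L1 L2 1 c1 c2 L0 (lexx _); rewrite subrr => /(_ _ t) H.
  suff : 0 < dot (val (L1 t)) (val (L2 t)) by lra.
  apply: H => s; rewrite P sum_dot_Pi3 S3_dot; lra.
suff : 1 - e < dot (val (L1 t)) (val (L2 t)) by lra.
by apply: lift_close => // s; rewrite P sum_dot_Pi3 S3_dot; lra.
Qed.

Section families.
Variables (X : topologicalType) (L : X -> I01 R -> S3 R).
Hypothesis L_continuous : forall x, continuous (L x).
Hypothesis L0 : forall x, L x (zero01 R) = S3one R.
Hypothesis smoothF : forall j, smooth_vfamily (fun x t => col j (Pi3 (L x t))).

Lemma lift_family_continuous i :
  continuous (fun p : X * I01 R => val (L p.1 p.2) i 0).
Proof.
move=> [x t] /=; apply/cvg_ballP => e e0.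
(* For unit quaternions, |z - w|^2 = 2 - 2 <z, w>: an inner product above 1 - d gives a squared
   distance below 2 d <= (e/2)^2. The minimum with 1 is for [lift_close]. *)
pose d := Num.min 1 ((e / 2) ^+ 2 / 2).
have d0 : 0 < d by rewrite lt_min ltr01 divr_gt0 // exprn_gt0 // divr_gt0.
have de : 2 * d <= (e / 2) ^+ 2.
  by rewrite mulrC -ler_pdivlMr // ge_min lexx orbT.
(* This is the square of the inner product of [L y s] and [L x s], written with frames because only
   their joint continuity is known so far. It equals 1 at y = x. *)
pose f y s := (1 + \sum_j dot (col j (Pi3 (L y s))) (col j (Pi3 (L x s)))) / 4.
have sf : smooth_family 0 f.
  apply: smooth_familyM; last exact: smooth_family_cst.
  apply: smooth_familyD; first exact: smooth_family_cst.
  apply: smooth_family_sum => j; apply: smooth_family_dot; first exact: smoothF.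
  have cx : continuous (fun _ : X => x) by exact: cst_continuous.
  exact: (smooth_vfamily_comp cx (smoothF j)).
have close : \forall y \near x, forall s, ball (f x s) d (f y s).
  exact: near_uniform_I01 (smooth_family_continuous sf) d0.
have nx : \forall y \near x, forall s,
    ball (val (L x s) i 0) (e / 2) (val (L y s) i 0).
  apply: filterS close => y xy s.
  have dot_close : 1 - d < dot (val (L y s)) (val (L x s)).
    apply: lift_close => //; rewrite ?L0 //; first by rewrite ge_min lexx.
    move=> r; have := xy r; rewrite /ball /= /f sum_dot_Pi3 S3_dot => /ltr_distlBl.
    lra.
  rewrite -ball_normE /= distrC -(@ltr_pXn2r _ 2) ?nnegrE ?normr_ge0 //; last first.
    by rewrite ltW // divr_gt0.
  rewrite real_normK ?num_real //; apply: lt_le_trans de.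
  have := sqr_coord_le_dot (val (L y s) - val (L x s)) i.
  rewrite dot_subS3 !mxE => /le_lt_trans; apply; lra.
have nt : \forall s \near t, ball (val (L x t) i 0) (e / 2) (val (L x s) i 0).
  have e20 : 0 < e / 2 by rewrite divr_gt0.
  move/S3_continuous: (@L_continuous x) => /(_ i t) /cvg_ballP; exact.
exists ([set y | forall s, ball (val (L x s) i 0) (e / 2) (val (L y s) i 0)],
  [set s | ball (val (L x t) i 0) (e / 2) (val (L x s) i 0)]) => //.
by move=> [y s] /= [xy ts]; exact: ball_split ts (xy s).
Qed.

(** Take w = [L x t] in [Pi3_recover]: the right side is differentiable in s, and the left side is 4
    u(s) [L x s] with u(s) the inner product with w. The derivative of u^2 at t is 0, since each
    column is a unit vector, orthogonal to its derivative. As u(t) = 1, also u'(t) = 0, and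
    [has_deriv_mulK] concludes. *)
Lemma lift_has_vderiv x t : has_vderiv (fun s => val (L x s)) t
  (4^-1 *: qmul (\sum_j qmul (qimag (deriv01 (fun s => col j (Pi3 (L x s))) t))
                             (qconj (qimag (col j (Pi3 (L x t)))))) (val (L x t))).
Proof.
have dF j := smooth_vfamily_deriv (smoothF j) x t.
pose u s := dot (val (L x s)) (val (L x t)).
have cu : u s @[s --> t] --> u t.
  apply: (@cvg_dot _ _ (nbhs t)) => i; last exact: cvg_cst.
  by move/S3_continuous: (@L_continuous x); exact.
have ut : u t = 1 by exact: S3_dot.
have du2 : has_deriv (fun s => u s ^+ 2) t 0.
  have -> : (fun s => u s ^+ 2) = (fun s =>
      4^-1 * (1 + \sum_j dot (col j (Pi3 (L x s))) (col j (Pi3 (L x t))))).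
    by apply: funext => s; rewrite sum_dot_Pi3 mulKf.
  have dsum : has_deriv (fun s => \sum_j dot (col j (Pi3 (L x s))) (col j (Pi3 (L x t))))
      t (\sum_(j < 3) 0).
    apply: has_deriv_sum => j.
    have := has_deriv_dot (dF j) (has_vderiv_cst (col j (Pi3 (L x t))) t).
    rewrite (dotC _ 0) dot0l addr0.
    rewrite (@dot_deriv_unit _ _ (fun s => col j (Pi3 (L x s))) t) //.
    by move=> s; rewrite Pi3_col_dot eqxx.
  have := has_derivM (has_deriv_cst 4^-1 t) (has_derivD (has_deriv_cst 1 t) dsum).
  by rewrite big1_eq mul0r add0r addr0 mulr0.
have du : has_deriv u t 0.
  have := has_deriv_of_sqr cu _ du2; rewrite mul0r; apply.
  by rewrite ut oner_eq0.
pose C j s := qimag (col j (Pi3 (L x s))).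
have dG : has_vderiv (fun s => qmul (qone R + \sum_j qmul (C j s) (qconj (C j t)))
    (val (L x t))) t (qmul (\sum_j qmul (qimag (deriv01 (fun s => col j (Pi3 (L x s))) t))
      (qconj (C j t))) (val (L x t))).
  have dsum : has_vderiv (fun s => \sum_j qmul (C j s) (qconj (C j t))) t
      (\sum_j qmul (qimag (deriv01 (fun s => col j (Pi3 (L x s))) t)) (qconj (C j t))).
    move=> i; rewrite summxE; under eq_fun do rewrite summxE.
    apply: has_deriv_sum => j.
    have h := has_vderiv_qmul (has_vderiv_qimag (dF j))
      (has_vderiv_cst (qconj (C j t)) t).
    by have := h i; rewrite qmul0r addr0.
  have := has_vderiv_qmul (has_vderivD (has_vderiv_cst (qone R) t) dsum)
    (has_vderiv_cst (val (L x t)) t).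
  by rewrite qmul0r addr0 add0r.
move=> i; have := dG i; under eq_fun do rewrite -Pi3_recover mxE -mulrA.
have cL : val (L x s) i 0 @[s --> t] --> val (L x t) i 0.
  by move/S3_continuous: (@L_continuous x); exact.
have d4 : has_deriv (fun s => 4 * u s) t 0.
  by have := has_derivM (has_deriv_cst 4 t) du; rewrite mul0r mulr0 addr0.
have u40 : 4 * u t != 0 by rewrite ut mulr1 pnatr_eq0.
under eq_fun do rewrite mulrA; move/(has_deriv_mulK cL u40 d4).
by rewrite mul0r subr0 ut mulr1 mulrC [X in _ -> has_deriv _ _ X]mxE.
Qed.

Lemma lift_smooth : smooth_vfamily (fun x t => val (L x t)).
Proof.
move=> i k; elim: k i => [|k IH] i; split; try exact: lift_family_continuous.
  by [].
exists (fun x t => (4^-1 *: qmul (\sum_j qmul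
    (qimag (deriv01 (fun s => col j (Pi3 (L x s))) t))
    (qconj (qimag (col j (Pi3 (L x t)))))) (val (L x t))) i 0).
  by move=> x t; exact: lift_has_vderiv.
under eq_fun do under eq_fun do rewrite mxE.
apply: smooth_familyM; first exact: smooth_family_cst.
apply: smooth_family_qmul => // {}i.
under eq_fun do under eq_fun do rewrite summxE.
apply: smooth_family_sum => j; apply: smooth_vfamily_qmul.
  exact/smooth_vfamily_qimag/smooth_vfamily_deriv01.
exact/smooth_vfamily_qconj/smooth_vfamily_qimag.
Qed.

End families.

End lifting.

(** * Recognizing generic curves by lifts of their frames *)

Section frames.
Variable R : realType.
Local Notation e := (qbasis R).
Implicit Types (z : S3 R) (t : I01 R).

Lemma qmulqV_qbasis (i : 'I_4) : qmul (e i) (qconj (e i)) = e 0.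
Proof. by rewrite qmulqV dot_qbasis eqxx scale1r qoneE. Qed.

Lemma qmulVq_qbasis (i : 'I_4) : qmul (qconj (e i)) (e i) = e 0.
Proof. by rewrite qmulVq dot_qbasis eqxx scale1r qoneE. Qed.

Lemma qconjZ c (q : quat R) : qconj (c *: q) = c *: qconj q.
Proof. by apply: quatP; rewrite ?qconjE !mxE /= ?mulrN. Qed.

Lemma qconj_qbasis0 : qconj (e 0) = e 0.
Proof. by rewrite -qoneE qconj1. Qed.

Lemma qvecZ c (q : quat R) : qvec (c *: q) = c *: qvec q.
Proof. by apply/colP => i; rewrite !mxE. Qed.

Lemma qmul_qbasis0r q : qmul q (e 0) = q. Proof. by rewrite -qoneE qmulq1. Qed.

Lemma qmul_qbasis0l q : qmul (e 0) q = q. Proof. by rewrite -qoneE qmul1q. Qed.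

Lemma col0_Pi3 z : col 0 (Pi3 z) = qvec (spin z z (e 1)).
Proof. by rewrite col_Pi3; congr (qvec (spin _ _ (e _))); exact: val_inj. Qed.

Lemma col1_Pi3 z : col 1 (Pi3 z) = qvec (spin z z (e 2)).
Proof. by rewrite col_Pi3; congr (qvec (spin _ _ (e _))); exact: val_inj. Qed.

Lemma col2_Pi3 z : col 2 (Pi3 z) = qvec (spin z z (e 3)).
Proof. by rewrite col_Pi3; congr (qvec (spin _ _ (e _))); exact: val_inj. Qed.

Lemma qimag_qvec_spin z (j : 'I_4) : j != 0 ->
  qimag (qvec (spin z z (e j))) = spin z z (e j).
Proof.
have [i ->|->] := unliftP 0 j; last by rewrite eqxx.
by rewrite -col_Pi3 qimag_col_Pi3.
Qed.

Lemma curve_eq m (g h : curve R m) : (forall t, g t = h t) -> g = h.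
Proof.
case: g h => [g sg] [h sh] /= /funext gh; case: _ / gh sh => sh.
by rewrite (Prop_irrelevance sg sh).
Qed.

Lemma normalize_scale m (c : R) (u : 'cV[R]_m) : 0 < c ->
  (enorm (c *: u))^-1 *: (c *: u) = (enorm u)^-1 *: u.
Proof.
move=> c0; rewrite enormZ gtr0_norm // scalerA invfM mulrC mulrA divff ?mul1r //.
by rewrite gt_eqF.
Qed.

Lemma normalizeK m (u : 'cV[R]_m) : 0 < enorm u ->
  enorm u *: ((enorm u)^-1 *: u) = u.
Proof. by move=> u0; rewrite scalerA divff ?scale1r // gt_eqF. Qed.

Lemma sphere_deriv_orthogonal n (g : curve R n.+1) t :
  (forall s, sphere (g s)) -> dot (deriv01 g t) (g t) = 0.
Proof.
move=> gS; apply: (@dot_deriv_unit _ _ g t).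
  by move=> s; apply/enorm1P; exact: gS.
exact: (curve_has_vderiv 0 g t).
Qed.

Lemma is_frenet_Pi3 (g : curve R 3) t z c :
  g t = col 0 (Pi3 z) -> deriv01 g t = c *: col 1 (Pi3 z) -> 0 < c ->
  is_frenet g t (Pi3 z).
Proof.
move=> g0 g1 c0; split; last exact: SO_Pi3.
rewrite (_ : derivs g 2 t = [:: g t; deriv01 g t]) // g0 g1.
rewrite gram_schmidt2_eq ?Pi3_col_dot //.
by move=> [[|[|//]] Hi] /=; congr col; exact: val_inj.
Qed.

Lemma is_frenet_Pi4 (g : curve R 4) t (z : S3 R * S3 R) (c a b d : R) :
  g t = col 0 (Pi4 z) -> deriv01 g t = c *: col 1 (Pi4 z) ->
  deriv01 (deriv01 g) t = a *: col 0 (Pi4 z) + b *: col 1 (Pi4 z) + d *: col 2 (Pi4 z) ->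
  0 < c -> 0 < d -> is_frenet g t (Pi4 z).
Proof.
move=> g0 g1 g2 c0 d0; split; last exact: SO_Pi4.
rewrite (_ : derivs g 3 t = [:: g t; deriv01 g t; deriv01 (deriv01 g) t]) //.
rewrite g0 g1 g2 gram_schmidt3_eq ?Pi4_col_dot //.
by move=> [[|[|[|//]]] Hi] /=; congr col; exact: val_inj.
Qed.

(** A path L whose first two columns are adapted to the curve, with positive speed, is itself the
    lift: Gram-Schmidt returns these columns, and [SO] determines the third. *)
Lemma GS2_intro (g : curve R 3) (L : I01 R -> S3 R) (c : I01 R -> R) :
  continuous L -> L (zero01 R) = S3one R ->
  (forall t, [/\ g t = col 0 (Pi3 (L t)), deriv01 g t = c t *: col 1 (Pi3 (L t)) &
                 0 < c t]) ->
  GS2 (L (one01 R)) g /\ is_lift (@Pi3 R) (S3one R) (frenet g) L.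
Proof.
move=> cL L0 gL.
have frenetE t : frenet g t = Pi3 (L t).
  by have [g0 g1 c0] := gL t; apply: frenet_eq; exact: is_frenet_Pi3 g0 g1 c0.
have liftL : is_lift (@Pi3 R) (S3one R) (frenet g) L by split.
split => //; split; last by exists L.
- move=> t; have [-> _ _] := gL t.
  by apply/enorm1P; rewrite Pi3_col_dot.
- move=> t; have [g0 g1 c0] := gL t.
  rewrite /derivs /= g0 g1.
  (* Independence of the two vectors follows from that of three, the third being
     [col 2 (Pi3 (L t))], written in the shape expected by [free_triangular3]. *)
  have : free [:: col 0 (Pi3 (L t)); c t *: col 1 (Pi3 (L t));
      0 *: col 0 (Pi3 (L t)) + 0 *: col 1 (Pi3 (L t)) + 1 *: col 2 (Pi3 (L t))].
    by apply: free_triangular3; rewrite ?Pi3_col_dot ?oner_eq0 // gt_eqF.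
  by rewrite -[[:: _; _; _]]/([:: _; _] ++ [:: _]) => /catl_free.
- by rewrite frenetE L0 Pi3_one.
Qed.

Lemma GS3_intro (g : curve R 4) (L : I01 R -> S3 R * S3 R) :
  continuous L -> L (zero01 R) = (S3one R, S3one R) ->
  (forall t, exists c a b d : R, [/\ g t = col 0 (Pi4 (L t)),
     deriv01 g t = c *: col 1 (Pi4 (L t)),
     deriv01 (deriv01 g) t =
       a *: col 0 (Pi4 (L t)) + b *: col 1 (Pi4 (L t)) + d *: col 2 (Pi4 (L t)),
     0 < c & 0 < d]) ->
  GS3 (L (one01 R)).1 (L (one01 R)).2 g.
Proof.
move=> cL L0 gL.
have frenetE t : frenet g t = Pi4 (L t).
  have [c [a [b [d [g0 g1 g2 c0 d0]]]]] := gL t.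
  by apply: frenet_eq; exact: is_frenet_Pi4 g0 g1 g2 c0 d0.
split.
- move=> t; have [c [a [b [d [-> _ _ _ _]]]]] := gL t.
  by apply/enorm1P; rewrite Pi4_col_dot.
- move=> t; have [c [a [b [d [g0 g1 g2 c0 d0]]]]] := gL t.
  rewrite /derivs /= g0 g1 g2.
  by apply: free_triangular3; rewrite ?Pi4_col_dot // gt_eqF.
- by rewrite frenetE L0 Pi4_one.
- by exists L; [split | case: (L _)].
Qed.

(** On the sphere g' is orthogonal to g, so the second step of Gram-Schmidt only normalizes g'; the
    normal then follows from [cross_Pi3]. *)
Lemma GS2_frame (g : curve R 3) z L t :
  GS2 z g -> is_lift (@Pi3 R) (S3one R) (frenet g) L ->
  [/\ g t = col 0 (Pi3 (L t)), 0 < enorm (deriv01 g t),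
      unit_tangent g t = col 1 (Pi3 (L t)) & unit_normal g t = col 2 (Pi3 (L t))].
Proof.
move=> [gS _ _ _] [_ _ PL].
have [gsE _] : is_frenet g t (frenet g t) by apply: frenet_SO; rewrite -PL; exact: SO_Pi3.
have g0 : col 0 (Pi3 (L t)) = g t.
  have := gsE 0; rewrite gram_schmidt2 /= (gS t) invr1 scale1r -PL => <-.
  by congr col; exact: val_inj.
have g1 : col 1 (Pi3 (L t)) = unit_tangent g t.
  rewrite /unit_tangent; have := gsE 1; rewrite gram_schmidt2 /= (gS t) invr1 scale1r.
  rewrite sphere_deriv_orthogonal // scale0r subr0 -PL => <-.
  by congr col; exact: val_inj.
split => //; last by rewrite /unit_normal -g0 -g1 cross_Pi3.
by apply: normalize_unit; rewrite -[_ *: _]/(unit_tangent g t) -g1 Pi3_col_dot.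
Qed.

Lemma GS3_frame (g : curve R 4) zl zr L t :
  GS3 zl zr g -> is_lift (@Pi4 R) (S3one R, S3one R) (frenet g) L ->
  let u := deriv01 (deriv01 g) t in
  let v := (enorm (deriv01 g t))^-1 *: deriv01 g t in
  let w := u - (dot u (g t) *: g t + dot u v *: v) in
  [/\ g t = col 0 (Pi4 (L t)), 0 < enorm (deriv01 g t), v = col 1 (Pi4 (L t)) &
      (enorm w)^-1 *: w = col 2 (Pi4 (L t))].
Proof.
move=> [gS _ _ _] [_ _ PL].
have [gsE _] : is_frenet g t (frenet g t) by apply: frenet_SO; rewrite -PL; exact: SO_Pi4.
have g0 : col 0 (Pi4 (L t)) = g t.
  have := gsE 0; rewrite gram_schmidt3 /= (gS t) invr1 scale1r -PL => <-.
  by congr col; exact: val_inj.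
have g1 : col 1 (Pi4 (L t)) = (enorm (deriv01 g t))^-1 *: deriv01 g t.
  have := gsE 1; rewrite gram_schmidt3 /= (gS t) invr1 scale1r.
  rewrite sphere_deriv_orthogonal // scale0r subr0 -PL => <-.
  by congr col; exact: val_inj.
split => //; first by apply: normalize_unit; rewrite -g1 Pi4_col_dot.
have := gsE 2; rewrite gram_schmidt3 /= (gS t) invr1 scale1r.
rewrite sphere_deriv_orthogonal // scale0r subr0 -PL => <-.
by congr col; exact: val_inj.
Qed.

End frames.

(** * From the 3-sphere to pairs of curves *)

Section forward.
Variables (R : realType) (zl zr : S3 R).
Local Notation e := (qbasis R).
Local Notation X := (set_type (GS3 zl zr)).
Implicit Types (x : X) (t : I01 R).

Let gamma x : curve R 4 := val x.

Let gamma_smooth : smooth_vfamily (fun x => gamma x).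
Proof. exact: smooth_vfamily_comp (@val_continuous _ _) (@smooth_vfamily_curve R 4). Qed.

Let gamma_GS3 x : GS3 zl zr (gamma x).
Proof. exact: set_valP. Qed.

Let gamma_lift x : exists2 L, is_lift (@Pi4 R) (S3one R, S3one R) (frenet (gamma x)) L &
  L (one01 R) = (zl, zr).
Proof. by have [_ _ _] := gamma_GS3 x. Qed.

(** The vector T. It is given by a formula in gamma and gamma', as are the maps built from it, so
    smooth dependence on gamma is a matter of closure properties; lifts serve for pointwise
    identities. *)
Definition tangent x t : quat R :=
  (enorm (deriv01 (gamma x) t))^-1 *: deriv01 (gamma x) t.

Let speed_gt0 x t : 0 < enorm (deriv01 (gamma x) t).
Proof. by have [L lL _] := gamma_lift x; have [] := GS3_frame t (gamma_GS3 x) lL. Qed.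

Let gamma'_smooth : smooth_vfamily (fun x => deriv01 (gamma x)).
Proof. exact: smooth_vfamily_deriv01. Qed.

Lemma tangent_smooth : smooth_vfamily tangent.
Proof. exact: smooth_vfamily_normalize. Qed.

(* The Gauss maps of gamma: in terms of a lift (a, b) of its frame, they are
   a i (qconj a) and b i (qconj b). *)
Definition left_map x t : 'cV[R]_3 := qvec (qmul (tangent x t) (qconj (gamma x t))).

Definition right_map x t : 'cV[R]_3 := qvec (qmul (qconj (gamma x t)) (tangent x t)).

Lemma left_map_smooth : smooth_vfamily left_map.
Proof.
apply: smooth_vfamily_qvec; apply: smooth_vfamily_qmul; first exact: tangent_smooth.
exact: smooth_vfamily_qconj.
Qed.

Lemma right_map_smooth : smooth_vfamily right_map.
Proof.
apply: smooth_vfamily_qvec; apply: smooth_vfamily_qmul; last exact: tangent_smooth.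
exact: smooth_vfamily_qconj.
Qed.

Definition left_curve x : curve R 3 := Curve (smooth_vfamily_smooth left_map_smooth x).

Definition right_curve x : curve R 3 := Curve (smooth_vfamily_smooth right_map_smooth x).

(** This is c2 N: the derivative of T freed of its component - c1 gamma. Its norm c2 will be the
    common speed of the two curves. *)
Let accel x t : quat R := deriv01 (tangent x) t + enorm (deriv01 (gamma x) t) *: gamma x t.

(** Since gamma'' = c1' T + c1 T', the third vector of Gram-Schmidt before normalization is c1 times
    [accel], and a positive factor does not affect the normalization. *)
Let frame x L : is_lift (@Pi4 R) (S3one R, S3one R) (frenet (gamma x)) L ->
  forall t, [/\ gamma x t = spin (L t).1 (L t).2 (e 0),
    tangent x t = spin (L t).1 (L t).2 (e 1),
    accel x t = enorm (accel x t) *: spin (L t).1 (L t).2 (e 2) &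
    0 < enorm (accel x t)].
Proof.
move=> lL t; have [g0 c0 g1 g2] := GS3_frame t (gamma_GS3 x) lL.
have T1 s : dot (tangent x s) (tangent x s) = 1.
  by have [_ _ gs _] := GS3_frame s (gamma_GS3 x) lL; rewrite /tangent gs Pi4_col_dot.
have dT := smooth_vfamily_deriv tangent_smooth x t.
have dg := smooth_vfamily_deriv gamma_smooth x t.
have [c1' dc] : exists c1', has_deriv (fun s => enorm (deriv01 (gamma x) s)) t c1'.
  have : smooth_family 1 (fun x t => enorm (deriv01 (gamma x) t)).
    exact: smooth_family_enorm.
  by case=> _ [h dh _]; exists (h x t).
set c := enorm (deriv01 (gamma x) t) in c0 g1 *.
have gT s : deriv01 (gamma x) s = enorm (deriv01 (gamma x) s) *: tangent x s.
  by rewrite -[LHS](normalizeK (speed_gt0 x s)).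
have g'' : deriv01 (deriv01 (gamma x)) t = c1' *: tangent x t + c *: deriv01 (tangent x) t.
  by apply: deriv01E; rewrite (funext gT); exact: has_vderivZ dc dT.
have Tg s : dot (tangent x s) (gamma x s) = 0.
  by rewrite dotZl sphere_deriv_orthogonal ?mulr0 //; have [] := gamma_GS3 x.
have T'g : dot (deriv01 (tangent x) t) (gamma x t) = - c.
  have : dot (deriv01 (tangent x) t) (gamma x t) +
         dot (tangent x t) (deriv01 (gamma x) t) = 0.
    apply: (has_deriv_uniq (has_deriv_dot dT dg)).
    by under eq_fun do rewrite Tg; exact: has_deriv_cst.
  by rewrite gT dotZr T1 mulr1 => /eqP; rewrite addr_eq0 => /eqP.
have T'T : dot (deriv01 (tangent x) t) (tangent x t) = 0.
  exact: dot_deriv_unit dT.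
move: g2; rewrite -/c -[c^-1 *: _]/(tangent x t) g''.
rewrite !dotDl ![dot (c1' *: _) _]dotZl ![dot (c *: _) _]dotZl Tg T'g T1 T'T.
have -> : c1' *: tangent x t + c *: deriv01 (tangent x) t -
    ((c1' * 0 + c * - c) *: gamma x t + (c1' * 1 + c * 0) *: tangent x t) =
    c *: accel x t.
  rewrite /accel -/c scalerDr scalerA; apply/colP => i; rewrite !mxE; ring.
rewrite normalize_scale // => g2.
have a0 : 0 < enorm (accel x t) by apply: normalize_unit; rewrite g2 Pi4_col_dot.
rewrite -!col_Pi4 -g0 -g1 -g2 normalizeK //; split => //.
Qed.

Let has_vderiv_tangent x L :
  is_lift (@Pi4 R) (S3one R, S3one R) (frenet (gamma x)) L ->
  forall t, has_vderiv (tangent x) t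
    (enorm (accel x t) *: spin (L t).1 (L t).2 (e 2) -
     enorm (deriv01 (gamma x) t) *: spin (L t).1 (L t).2 (e 0)).
Proof.
move=> lL t; have [g0 _ <- _] := frame lL t.
by rewrite /accel -g0 addrK; exact: (smooth_vfamily_deriv tangent_smooth x t).
Qed.

Arguments has_vderiv_tangent {x L} _ t _.

Let has_vderiv_gamma x L :
  is_lift (@Pi4 R) (S3one R, S3one R) (frenet (gamma x)) L ->
  forall t, has_vderiv (gamma x) t
    (enorm (deriv01 (gamma x) t) *: spin (L t).1 (L t).2 (e 1)).
Proof.
move=> lL t; have [_ <- _ _] := frame lL t; rewrite normalizeK //.
exact: (smooth_vfamily_deriv gamma_smooth x t).
Qed.

Arguments has_vderiv_gamma {x L} _ t _.

(** In the derivative of T (qconj gamma), the term - c1 gamma (qconj gamma) cancels c1 T (qconj T),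
    both gamma and T being units. There remains c2 N (qconj gamma) = c2 a j (qconj a). The right
    curve has the same cancellation. *)
Let left_curve_frame x L : is_lift (@Pi4 R) (S3one R, S3one R) (frenet (gamma x)) L ->
  forall t, [/\ left_curve x t = col 0 (Pi3 (L t).1),
    deriv01 (left_curve x) t = enorm (accel x t) *: col 1 (Pi3 (L t).1) &
    0 < enorm (accel x t)].
Proof.
move=> lL t; have [g0 g1 _ c0] := frame lL t; split => //.
  by rewrite col0_Pi3 /= /left_map g0 g1 spin_mulVr qconj_qbasis0 qmul_qbasis0r.
apply: deriv01E; rewrite col1_Pi3 -qvecZ.
have := has_vderiv_qvec (has_vderiv_qmul (has_vderiv_tangent lL t)
  (has_vderiv_qconj (has_vderiv_gamma lL t))).
congr has_vderiv; congr qvec; rewrite g0 g1 qconjZ qmulZr qmulDl -scaleNr !qmulZl.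
by rewrite !spin_mulVr !qmulqV_qbasis qconj_qbasis0 qmul_qbasis0r -addrA scaleNr addNr addr0.
Qed.

Let right_curve_frame x L : is_lift (@Pi4 R) (S3one R, S3one R) (frenet (gamma x)) L ->
  forall t, [/\ right_curve x t = col 0 (Pi3 (L t).2),
    deriv01 (right_curve x) t = enorm (accel x t) *: col 1 (Pi3 (L t).2) &
    0 < enorm (accel x t)].
Proof.
move=> lL t; have [g0 g1 _ c0] := frame lL t; split => //.
  by rewrite col0_Pi3 /= /right_map g0 g1 spin_mulVl qconj_qbasis0 qmul_qbasis0l.
apply: deriv01E; rewrite col1_Pi3 -qvecZ.
have := has_vderiv_qvec (has_vderiv_qmul (has_vderiv_qconj (has_vderiv_gamma lL t))
  (has_vderiv_tangent lL t)).
congr has_vderiv; congr qvec; rewrite g0 g1 qconjZ qmulZl qmulDr -scaleNr !qmulZr.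
rewrite !spin_mulVl !qmulVq_qbasis qconj_qbasis0 qmul_qbasis0l addrCA scaleNr subrr addr0.
by [].
Qed.

Lemma left_right_lift x L : is_lift (@Pi4 R) (S3one R, S3one R) (frenet (gamma x)) L ->
  L (one01 R) = (zl, zr) ->
  [/\ GS2 zl (left_curve x),
      is_lift (@Pi3 R) (S3one R) (frenet (left_curve x)) (fun t => (L t).1),
      GS2 zr (right_curve x) &
      is_lift (@Pi3 R) (S3one R) (frenet (right_curve x)) (fun t => (L t).2)].
Proof.
move=> lL L1; have [cL L0 _] := lL.
have cL1 : continuous (fun t => (L t).1).
  by move=> t; apply: (cvg_comp _ _ (cL t)); exact: cvg_fst.
have cL2 : continuous (fun t => (L t).2).
  by move=> t; apply: (cvg_comp _ _ (cL t)); exact: cvg_snd.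
have [Gl ll] := GS2_intro cL1 (congr1 fst L0) (left_curve_frame lL).
have [Gr lr] := GS2_intro cL2 (congr1 snd L0) (right_curve_frame lL).
by move: Gl Gr; rewrite L1.
Qed.

Let accel_smooth : smooth_vfamily accel.
Proof.
apply: smooth_vfamilyD; first exact: smooth_vfamily_deriv01 tangent_smooth.
by apply: smooth_vfamilyZ => // k; exact: smooth_family_enorm.
Qed.

Let normal x t : quat R := (enorm (accel x t))^-1 *: accel x t.

Let normal_smooth : smooth_vfamily normal.
Proof.
apply: smooth_vfamily_normalize accel_smooth _ => x t.
by have [L lL _] := gamma_lift x; have [] := frame lL t.
Qed.

Let normalE x L : is_lift (@Pi4 R) (S3one R, S3one R) (frenet (gamma x)) L ->
  forall t, normal x t = spin (L t).1 (L t).2 (e 2).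
Proof.
move=> lL t; have [_ _ aE a0] := frame lL t.
by rewrite /normal {2}aE scalerA mulVf ?scale1r // gt_eqF.
Qed.

Lemma left_right_pair x : GS2_pairs zl zr (left_curve x, right_curve x).
Proof.
have [L lL L1] := gamma_lift x.
have [Gl ll Gr lr] := left_right_lift lL L1.
suff pair t : enorm (deriv01 (left_curve x) t) = enorm (deriv01 (right_curve x) t) /\
    geod_curv (left_curve x) t > geod_curv (right_curve x) t.
  by split; [exact: Gl | exact: Gr | exact: pair].
have speedl : enorm (deriv01 (left_curve x) t) = enorm (accel x t).
  have [_ -> c0] := left_curve_frame lL t.
  by rewrite enormZ (iffRL (enorm1P _) (Pi3_col_dot _ 1 1)) mulr1 gtr0_norm.
have speedr : enorm (deriv01 (right_curve x) t) = enorm (accel x t).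
  have [_ -> c0] := right_curve_frame lL t.
  by rewrite enormZ (iffRL (enorm1P _) (Pi3_col_dot _ 1 1)) mulr1 gtr0_norm.
split; first by rewrite speedl speedr.
have [g0 g1 _ a0] := frame lL t.
have n2 := normalE lL t.
rewrite /geod_curv speedl speedr ltr_pM2r ?invr_gt0 //.
have [_ _ _ ->] := GS2_frame t Gl ll; have [_ _ _ ->] := GS2_frame t Gr lr.
set c := enorm (deriv01 (gamma x) t); set K := dot (deriv01 (normal x) t)
  (spin (L t).1 (L t).2 (e 3)).
have dn := smooth_vfamily_deriv normal_smooth x t.
(* The unit tangent is N (qconj gamma); K comes from differentiating N, and c from differentiating
   gamma. *)
have dotl : dot (deriv01 (unit_tangent (left_curve x)) t) (col 2 (Pi3 (L t).1)) = K + c.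
  have -> : unit_tangent (left_curve x) =
      fun s => qvec (qmul (normal x s) (qconj (gamma x s))).
    apply: funext => s; have [_ _ -> _] := GS2_frame s Gl ll.
    have [gs _ _ _] := frame lL s.
    by rewrite (normalE lL) gs spin_mulVr qconj_qbasis0 qmul_qbasis0r col1_Pi3.
  rewrite (deriv01E (has_vderiv_qvec (has_vderiv_qmul dn
    (has_vderiv_qconj (has_vderiv_gamma lL t))))).
  rewrite col2_Pi3 dot_qvec qimag_qvec_spin // dotDl; congr (_ + _).
    by rewrite dot_qmulr qconjK g0 spin_mulr qmul_qbasis0r.
  rewrite n2 qconjZ qmulZr dotZl spin_mulVr dot_spin.
  (* Noncommutativity separates the curvatures: j (qconj i) = k here, but (qconj i) j = - k for the
     right curve, so c enters with opposite signs. *)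
  have -> : qmul (e 2) (qconj (e 1)) = e 3.
    by apply: quatP; rewrite qmulE !qconjE !qbasisE /=; ring.
  by rewrite dot_qbasis eqxx mulr1.
have dotr : dot (deriv01 (unit_tangent (right_curve x)) t) (col 2 (Pi3 (L t).2)) = K - c.
  have -> : unit_tangent (right_curve x) =
      fun s => qvec (qmul (qconj (gamma x s)) (normal x s)).
    apply: funext => s; have [_ _ -> _] := GS2_frame s Gr lr.
    have [gs _ _ _] := frame lL s.
    by rewrite (normalE lL) gs spin_mulVl qconj_qbasis0 qmul_qbasis0l col1_Pi3.
  rewrite (deriv01E (has_vderiv_qvec (has_vderiv_qmul
    (has_vderiv_qconj (has_vderiv_gamma lL t)) dn))).
  rewrite col2_Pi3 dot_qvec qimag_qvec_spin // dotDl addrC; congr (_ + _).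
    by rewrite dot_qmull qconjK g0 spin_mulr qmul_qbasis0l.
  rewrite n2 qconjZ qmulZl dotZl spin_mulVl dot_spin.
  have -> : qmul (qconj (e 1)) (e 2) = - e 3.
    by apply: quatP; rewrite coordN qmulE !qconjE !qbasisE /=; ring.
  by rewrite dotNl dot_qbasis eqxx mulrN mulr1.
have c_gt0 : 0 < c by exact: speed_gt0.
by rewrite [X in X < _]dotr [X in _ < X]dotl ltrD2l (lt_trans _ c_gt0) // oppr_lt0.
Qed.

Definition left_right (x : X) : GS2_pairs zl zr :=
  exist _ (left_curve x, right_curve x) (mem_set (left_right_pair x)).

Lemma left_right_continuous : continuous left_right.
Proof.
apply: continuous_valP => x; apply: continuous_pair_at.
  exact: (@continuous_curve _ _ _ left_curve left_map_smooth x).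
exact: (@continuous_curve _ _ _ right_curve right_map_smooth x).
Qed.

End forward.

(** * From pairs of curves to the 3-sphere *)

Section backward.
Variables (R : realType).
Local Notation e := (qbasis R).
Implicit Types t : I01 R.

Lemma has_vderiv_spin (a b : I01 R -> S3 R) t (p r q : quat R) :
  has_vderiv (fun s => val (a s)) t (qmul (val (a t)) p) ->
  has_vderiv (fun s => val (b s)) t (qmul (val (b t)) r) ->
  has_vderiv (fun s => spin (a s) (b s) q) t
    (spin (a t) (b t) (qmul p q + qmul q (qconj r))).
Proof.
move=> da db.
have := has_vderiv_qmul (has_vderiv_qmul da (has_vderiv_cst q t)) (has_vderiv_qconj db).
by rewrite qmul0r addr0 spinD /spin qconjM !qmulA.
Qed.

(** With w = w0 + w1 i + w2 j + w3 k, the left side of the first hypothesis is 2 (w0 i + w3 j - w2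
    k), and that of the second is 2 w1. The halves reflect that conjugation rotates twice as fast as
    the lift. *)
Lemma angular_velocity_eq (w : quat R) (c k : R) :
  qmul w (e 1) + qmul (e 1) (qconj w) = c *: e 2 ->
  dot (qmul w (e 2) + qmul (e 2) (qconj w)) (e 3) = c * k ->
  w = (c * k / 2) *: e 1 + (c / 2) *: e 3.
Proof.
move=> w1 w2.
have coord i := congr1 (fun q : quat R => q i 0) w1.
move: w2 (coord 1) (coord 2) (coord 3).
rewrite quat_dotE !coordZ !coordD !qmulE !qconjE !qbasisE /= => e0 e1 e2 e3.
by apply: quatP; rewrite coordD !coordZ !qbasisE /=; lra.
Qed.

Definition spin_lift (g : curve R 3) : I01 R -> S3 R :=
  xget (fun=> S3one R) (is_lift (@Pi3 R) (S3one R) (frenet g)).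

(** [GSn] speaks of the endpoint of some lift; [lift_uniq] transfers it to the chosen one. *)
Lemma GS2_spin_lift z (g : curve R 3) : GS2 z g ->
  is_lift (@Pi3 R) (S3one R) (frenet g) (spin_lift g) /\ spin_lift g (one01 R) = z.
Proof.
move=> [_ _ _ [L lL Lz]].
have lg : is_lift (@Pi3 R) (S3one R) (frenet g) (spin_lift g).
  by apply: xgetPex; exists L.
split=> //; rewrite -Lz; congr (_ _).
case: lL lg => cL L0 PL [cg g0 Pg].
by apply: lift_uniq => // [|t]; rewrite ?g0 ?Pg.
Qed.

Lemma spin_lift_eq (g : curve R 3) L :
  is_lift (@Pi3 R) (S3one R) (frenet g) L -> spin_lift g = L.
Proof.
move=> lL; have [cg g0 Pg] : is_lift (@Pi3 R) (S3one R) (frenet g) (spin_lift g).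
  by apply: xgetPex; exists L.
case: lL => cL L0 PL.
by apply: lift_uniq => // [|t]; rewrite ?g0 ?Pg.
Qed.

(** * Lifts of families of curves on the 2-sphere *)

Section lift_families.
Variables (X : topologicalType) (z : S3 R) (G : X -> curve R 3).
Hypothesis G_continuous : continuous G.
Hypothesis G_GS2 : forall x, GS2 z (G x).

Let frameG x t := GS2_frame t (G_GS2 x) (GS2_spin_lift (G_GS2 x)).1.

Lemma curve_family_smooth : smooth_vfamily (fun x => G x).
Proof. exact: (smooth_vfamily_comp G_continuous (@smooth_vfamily_curve R 3)). Qed.

Lemma unit_tangent_smooth : smooth_vfamily (fun x => unit_tangent (G x)).
Proof.
apply: smooth_vfamily_normalize; first exact: smooth_vfamily_deriv01 curve_family_smooth.
by move=> x t; have [] := frameG x t.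
Qed.

Lemma spin_lift_smooth : smooth_vfamily (fun x t => val (spin_lift (G x) t)).
Proof.
apply: lift_smooth => [x|x|].
- by have [[]] := GS2_spin_lift (G_GS2 x).
- by have [[]] := GS2_spin_lift (G_GS2 x).
apply: ord3_ind.
- rewrite (_ : (fun x t => _) = fun x => G x); first exact: curve_family_smooth.
  by apply: funext => x; apply: funext => t; have [<-] := frameG x t.
- rewrite (_ : (fun x t => _) = fun x => unit_tangent (G x)).
    exact: unit_tangent_smooth.
  by apply: funext => x; apply: funext => t; have [_ _ <-] := frameG x t.
(* The third column is the cross product of the first two, written with quaternions so that the
   closure lemmas apply. *)
- rewrite (_ : (fun x t => _) = fun x t =>
      qvec (qmul (qimag (G x t)) (qimag (unit_tangent (G x) t)))).
    apply: smooth_vfamily_qvec; apply: smooth_vfamily_qmul;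
      apply: smooth_vfamily_qimag; [exact: curve_family_smooth | exact: unit_tangent_smooth].
  apply: funext => x; apply: funext => t; have [-> _ -> _] := frameG x t.
  by rewrite col0_Pi3 col1_Pi3 col2_Pi3 !qimag_qvec_spin // spin_mulr qmul_ij.
Qed.

(** Put w = (qconj a) a'. Differentiating a i (qconj a) = G and a j (qconj a) = T, and comparing
    with G' = c T and the definition of the curvature, gives the hypotheses of
    [angular_velocity_eq]. *)
Lemma spin_lift_has_vderiv x t :
  has_vderiv (fun s => val (spin_lift (G x) s)) t
    (qmul (val (spin_lift (G x) t))
      ((enorm (deriv01 (G x) t) * geod_curv (G x) t / 2) *: e 1 +
       (enorm (deriv01 (G x) t) / 2) *: e 3)).
Proof.
set c := enorm (deriv01 (G x) t); set L := spin_lift (G x).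
have [g0 c0 g1 g2] := frameG x t.
have dL := smooth_vfamily_deriv spin_lift_smooth x t.
have dG := smooth_vfamily_deriv curve_family_smooth x t.
have dT := smooth_vfamily_deriv unit_tangent_smooth x t.
set w := qmul (qconj (val (L t))) (deriv01 (fun s => val (L s)) t).
have dE : deriv01 (fun s => val (L s)) t = qmul (val (L t)) w by rewrite qmulS3VK.
have d_spin q : has_vderiv (fun s => spin (L s) (L s) q) t
    (spin (L t) (L t) (qmul w q + qmul q (qconj w))).
  by apply: has_vderiv_spin; rewrite -dE.
have e1 : qmul w (e 1) + qmul (e 1) (qconj w) = c *: e 2.
  apply: (@spin_inj _ (L t) (L t)); apply: (has_vderiv_uniq (d_spin (e 1))).
  have := has_vderiv_qimag dG; rewrite -(normalizeK c0) -[_^-1 *: _]/(unit_tangent (G x) t).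
  rewrite g1 col1_Pi3 qimagZ qimag_qvec_spin // -spinZ.
  rewrite (_ : (fun s => _) = fun s => spin (L s) (L s) (e 1)) //.
  apply: funext => s; have [-> _ _ _] := frameG x s.
  by rewrite col0_Pi3 qimag_qvec_spin.
have e2 : dot (qmul w (e 2) + qmul (e 2) (qconj w)) (e 3) = c * geod_curv (G x) t.
  have -> : c * geod_curv (G x) t = dot (deriv01 (unit_tangent (G x)) t) (unit_normal (G x) t).
    by rewrite mulrC divfK // gt_eqF.
  rewrite g2 col2_Pi3 -dot_qimag qimag_qvec_spin // -(dot_spin (L t) (L t)).
  congr dot; apply: (has_vderiv_uniq (d_spin (e 2))).
  have := has_vderiv_qimag dT.
  rewrite (_ : (fun s => _) = fun s => spin (L s) (L s) (e 2)) //.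
  apply: funext => s; have [_ _ -> _] := frameG x s.
  by rewrite col1_Pi3 qimag_qvec_spin.
by rewrite -(angular_velocity_eq e1 e2) -dE.
Qed.

End lift_families.

Arguments spin_lift_has_vderiv {X z G} _ _ x t _.

Variables (zl zr : S3 R).
Local Notation X := (set_type (GS2_pairs zl zr)).
Implicit Types x : X.

Let gl x : curve R 3 := (val x).1.
Let gr x : curve R 3 := (val x).2.

Let gl_continuous : continuous gl.
Proof. by move=> x; apply: (cvg_comp _ _ (@val_continuous _ _ x)); exact: cvg_fst. Qed.

Let gr_continuous : continuous gr.
Proof. by move=> x; apply: (cvg_comp _ _ (@val_continuous _ _ x)); exact: cvg_snd. Qed.

Let gl_GS2 x : GS2 zl (gl x). Proof. by have [] := set_valP x. Qed.
Let gr_GS2 x : GS2 zr (gr x). Proof. by have [] := set_valP x. Qed.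

Let Ll x := spin_lift (gl x).
Let Lr x := spin_lift (gr x).

Definition join_map x t : quat R := qmul (val (Ll x t)) (qconj (val (Lr x t))).

Lemma join_map_smooth : smooth_vfamily join_map.
Proof.
apply: smooth_vfamily_qmul; first exact: spin_lift_smooth gl_continuous gl_GS2.
by apply: smooth_vfamily_qconj; exact: spin_lift_smooth gr_continuous gr_GS2.
Qed.

Definition join_curve x : curve R 4 := Curve (smooth_vfamily_smooth join_map_smooth x).

Lemma join_mapE x t : join_map x t = spin (Ll x t) (Lr x t) (e 0).
Proof. by rewrite /spin qmul_qbasis0r. Qed.

Let speed x t := enorm (deriv01 (gl x) t).
Let cl x t := speed x t * geod_curv (gl x) t / 2.
Let cr x t := speed x t * geod_curv (gr x) t / 2.

Let speed_gt0 x t : 0 < speed x t.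
Proof. by have [] := GS2_frame t (gl_GS2 x) (GS2_spin_lift (gl_GS2 x)).1. Qed.

Let curv_gt0 x t : 0 < cl x t - cr x t.
Proof.
have [_ _ /(_ t) [_ lr]] := set_valP x.
by rewrite subr_gt0 ltr_pM2r ?invr_gt0 // ltr_pM2l.
Qed.

(** The derivative of a q (qconj b) seen in the moving frame. Equality of speeds puts the same
    k-component in both angular velocities: it cancels for q = 1, and adds up for q = i to give the
    positive coefficient of j. *)
Let spin_deriv x t q : quat R :=
  qmul (cl x t *: e 1 + (speed x t / 2) *: e 3) q +
  qmul q (qconj (cr x t *: e 1 + (speed x t / 2) *: e 3)).

Let has_vderiv_spin_lifts x t q :
  has_vderiv (fun s => spin (Ll x s) (Lr x s) q) t
    (spin (Ll x t) (Lr x t) (spin_deriv x t q)).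
Proof.
apply: has_vderiv_spin.
  exact: (spin_lift_has_vderiv gl_continuous gl_GS2 x t).
have [_ _ /(_ t) [sp _]] := set_valP x.
rewrite /cr /speed [enorm (deriv01 (gl x) t)]sp.
exact: (spin_lift_has_vderiv gr_continuous gr_GS2 x t).
Qed.

Arguments has_vderiv_spin_lifts x t q _ : clear implicits.

Let spin_deriv0 x t : spin_deriv x t (e 0) = (cl x t - cr x t) *: e 1.
Proof.
rewrite /spin_deriv qmul_qbasis0r qmul_qbasis0l.
move: (cl x t) (cr x t) (speed x t) => a b c.
by apply: quatP; rewrite !mxE /=; ring.
Qed.

Let spin_deriv1 x t :
  spin_deriv x t (e 1) = (- (cl x t - cr x t)) *: e 0 + speed x t *: e 2.
Proof.
rewrite /spin_deriv; move: (cl x t) (cr x t) (speed x t) => a b c.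
by apply: quatP; rewrite !coordD !qmulE !(qconjE, coordD, coordZ) !qbasisE /=; field.
Qed.

Lemma join_curve_deriv x t : deriv01 (join_curve x) t =
  (cl x t - cr x t) *: spin (Ll x t) (Lr x t) (e 1).
Proof.
apply: deriv01E; rewrite -spinZ -spin_deriv0 /=.
rewrite (_ : join_map x = fun s => spin (Ll x s) (Lr x s) (e 0)).
  exact: has_vderiv_spin_lifts.
by apply: funext => s; rewrite join_mapE.
Qed.

Lemma join_curve_deriv2 x t : exists b, deriv01 (deriv01 (join_curve x)) t =
  (- (cl x t - cr x t) ^+ 2) *: spin (Ll x t) (Lr x t) (e 0) +
  b *: spin (Ll x t) (Lr x t) (e 1) +
  ((cl x t - cr x t) * speed x t) *: spin (Ll x t) (Lr x t) (e 2).
Proof.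
have dE : deriv01 (join_curve x) = fun s =>
    (cl x s - cr x s) *: spin (Ll x s) (Lr x s) (e 1).
  by apply: funext => s; exact: join_curve_deriv.
have d1 := has_vderiv_spin_lifts x t (e 1).
have d2 := curve_has_vderiv 1 (join_curve x) t.
(* The speed [cl x t - cr x t] is the inner product of gamma' with a i (qconj b). This shows that it
   is differentiable, and [b] is its derivative. *)
have dc := has_deriv_dot d2 d1.
have cE : (fun s => dot (iter 1 (@deriv01 R 4) (join_curve x) s)
    (spin (Ll x s) (Lr x s) (e 1))) = fun s => cl x s - cr x s.
  by apply: funext => s /=; rewrite dE dotZl dot_spin dot_qbasis eqxx mulr1.
move: dc; rewrite cE; set b := (X in has_deriv _ _ X) => dc.
exists b; apply: deriv01E; rewrite dE.
suff <- : b *: spin (Ll x t) (Lr x t) (e 1) +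
    (cl x t - cr x t) *: spin (Ll x t) (Lr x t) (spin_deriv x t (e 1)) =
    (- (cl x t - cr x t) ^+ 2) *: spin (Ll x t) (Lr x t) (e 0) +
    b *: spin (Ll x t) (Lr x t) (e 1) +
    ((cl x t - cr x t) * speed x t) *: spin (Ll x t) (Lr x t) (e 2).
  exact: (has_vderivZ dc d1).
rewrite spin_deriv1 spinD !spinZ scalerDr !scalerA mulrN -expr2 addrCA addrA.
by [].
Qed.

Lemma join_curve_GS3 x : GS3 zl zr (join_curve x).
Proof.
have [[cL L0 _] L1] := GS2_spin_lift (gl_GS2 x).
have [[cR R0 _] R1] := GS2_spin_lift (gr_GS2 x).
have := @GS3_intro _ (join_curve x) (fun t => (Ll x t, Lr x t)).
rewrite /Ll /Lr L1 R1 L0 R0; apply => //.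
  by move=> t; apply: continuous_pair_at; [exact: cL | exact: cR].
move=> t; have [b d2] := join_curve_deriv2 x t.
exists (cl x t - cr x t), (- (cl x t - cr x t) ^+ 2), b,
  ((cl x t - cr x t) * speed x t); rewrite !col_Pi4 /=; split.
- exact: join_mapE.
- exact: join_curve_deriv.
- exact: d2.
- exact: curv_gt0.
- by rewrite mulr_gt0.
Qed.

Definition join (x : X) : GS3 zl zr := exist _ (join_curve x) (mem_set (join_curve_GS3 x)).

Lemma join_continuous : continuous join.
Proof.
apply: continuous_valP => x.
exact: (@continuous_curve _ _ _ join_curve join_map_smooth x).
Qed.

(** By uniqueness, the lifts chosen for the left and right curves are the two components of the lift
    of gamma, and a (qconj b) is the first column of its frame. *)
Lemma left_rightK : cancel (@left_right R zl zr) join.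
Proof.
move=> x; apply: val_inj; apply: curve_eq => t.
have [_ _ _ [L lL L1]] := set_valP x.
have [_ ll _ lr] := left_right_lift lL L1.
rewrite /= /join_map /Ll /Lr /= (spin_lift_eq ll) (spin_lift_eq lr).
have [-> _ _ _] := GS3_frame t (set_valP x) lL.
by rewrite col_Pi4 /spin -qoneE qmulq1.
Qed.

Lemma joinK : cancel join (@left_right R zl zr).
Proof.
move=> x; apply: val_inj.
have tE t : tangent (join x) t = spin (Ll x t) (Lr x t) (e 1).
  rewrite /tangent /= join_curve_deriv; apply: normalizeZ; first exact: curv_gt0.
  by rewrite dot_spin dot_qbasis eqxx.
have lE : left_curve (join x) = gl x.
  apply: curve_eq => t.
  have [-> _ _ _] := GS2_frame t (gl_GS2 x) (GS2_spin_lift (gl_GS2 x)).1.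
  rewrite /= /left_map tE /= join_mapE spin_mulVr qconj_qbasis0 qmul_qbasis0r.
  by rewrite col0_Pi3.
have rE : right_curve (join x) = gr x.
  apply: curve_eq => t.
  have [-> _ _ _] := GS2_frame t (gr_GS2 x) (GS2_spin_lift (gr_GS2 x)).1.
  rewrite /= /right_map tE /= join_mapE spin_mulVl qconj_qbasis0 qmul_qbasis0l.
  by rewrite col0_Pi3.
transitivity (left_curve (join x), right_curve (join x)); first by [].
by rewrite lE rE -surjective_pairing.
Qed.

End backward.

Theorem theorem3 (R : realType) (zl zr : S3 R) :
  homeomorphic (GS3 zl zr) (GS2_pairs zl zr).
Proof.
exists (@left_right R zl zr), (@join R zl zr); split.
- exact: left_right_continuous.
- exact: join_continuous.
- exact: left_rightK.
- exact: joinK.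
Qed.
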